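(* For each prime power $q$ there exists an integer $n$ such that, if $M$ is a round matroid that contains a $U_{2,q+2}$-restriction and a $\mathrm{PG}(n-1,q)$-minor, then $M$ contains a $U_{2,q^2+1}$-minor.
   Context: A matroid $M$ is round if $E(M)$ cannot be partitioned into two sets each of rank less than $r(M)$. $\mathrm{PG}(n-1,q)$ is the rank-$n$ projective geometry over $\mathrm{GF}(q)$; $U_{2,m}$ is the uniform matroid of rank $2$ on $m$ elements. *)

(* Defs.v *)
From HB Require Import structures.
From mathcomp Require Import all_boot all_order all_algebra all_field.
Set Implicit Arguments. Unset Strict Implicit. Unset Printing Implicit Defensive.
Import GRing.Theory.

(* A matroid on a finite set E (a subset of a finType T), given by its rank
   function.  The rank function is defined on all subsets of T but only
   depends on the part inside E. *)
Record matroid (T : finType) := Matroid {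
  ground : {set T};
  rk : {set T} -> nat;
  rk_ground : forall X : {set T}, rk X = rk (X :&: ground);
  rk_card : forall X : {set T}, rk X <= #|X|;
  rk_mono : forall X Y : {set T}, X \subset Y -> rk X <= rk Y;
  rk_submod : forall X Y : {set T}, rk (X :|: Y) + rk (X :&: Y) <= rk X + rk Y
}.

Definition mrank T (M : matroid T) : nat := rk M (ground M).

Definition round T (M : matroid T) : Prop :=
  ~ (exists X Y : {set T},
        [/\ X :|: Y = ground M, [disjoint X & Y],
            rk M X < mrank M & rk M Y < mrank M]).

Definition iso_rk (T1 T2 : finType) (E1 : {set T1}) (r1 : {set T1} -> nat)
  (E2 : {set T2}) (r2 : {set T2} -> nat) : Prop :=
  exists f : T1 -> T2,
    [/\ {in E1 &, injective f}, f @: E1 = E2 &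
        forall X : {set T1}, X \subset E1 -> r2 (f @: X) = r1 X].

Definition minor_ground T (M : matroid T) (C D : {set T}) : {set T} :=
  ground M :\: (C :|: D).
Definition minor_rk T (M : matroid T) (C D : {set T}) (X : {set T}) : nat :=
  rk M ((X :&: minor_ground M C D) :|: C) - rk M C.

Definition has_minor T T' (M : matroid T) (E2 : {set T'}) (r2 : {set T'} -> nat)
  : Prop :=
  exists C D : {set T},
    [/\ C \subset ground M, D \subset ground M, [disjoint C & D] &
        iso_rk (minor_ground M C D) (minor_rk M C D) E2 r2].

Definition has_restriction T T' (M : matroid T) (E2 : {set T'})
  (r2 : {set T'} -> nat) : Prop :=
  exists X : {set T},
    X \subset ground M /\ iso_rk X (fun Y => rk M (Y :&: X)) E2 r2.

Definition U2_ground (m : nat) : {set 'I_m} := [set: 'I_m].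
Definition U2_rk (m : nat) (X : {set 'I_m}) : nat := minn #|X| 2.

(* PG(n-1, F) for a finite field F: the points are the nonzero vectors of
   F^n normalised so that their first nonzero coordinate is 1 (one
   representative per 1-dimensional subspace); the rank of a set of points
   is the dimension of the subspace they span. *)
Definition pg_point (F : finFieldType) (n : nat) (v : 'rV[F]_n) : bool :=
  [exists i : 'I_n, (v ord0 i == 1%R) && [forall j : 'I_n, (j < i)%N ==> (v ord0 j == 0%R)]].

Definition PG_ground (F : finFieldType) (n : nat) : {set 'rV[F]_n} :=
  [set v | pg_point v].

Definition PG_rk (F : finFieldType) (n : nat) (X : {set 'rV[F]_n}) : nat :=
  \rank (\sum_(v in setI X (PG_ground F n)) <<v>>)%MS.

(* Main.v *)
Require Import Defs.
From HB Require Import structures.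
From Stdlib Require Import Btauto.
From mathcomp Require Import all_boot all_order all_algebra all_field.
From mathcomp Require Import zify.
Set Implicit Arguments. Unset Strict Implicit. Unset Printing Implicit Defensive.
Import GRing.Theory.

(** Suppose first that the round matroid [M] has a PG(k-1,q)-restriction [R] with
    [k >= 3], and let [L] be the (q+2)-point line. Roundness lets us contract
    elements outside the closures of [R] and [L] until [R] spans. Some point [z] of
    [L] is then not parallel to a point of [R]. By modularity at most one line
    of [R] spans [z], so we may contract points of [R] down to rank 3 keeping
    [z] off [R], and contracting [z] leaves at least q^2+1 points on a line.

    To reach such a restriction, contract the part of the minor's contraction set
    that is skew to [L]; the rest lies in the closure of two points [e], [f] of [L],
    so that [M / e / f] has a large projective geometry. It remains to undo the
    contraction of one point [e] (twice). In [M], each point of the geometry of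
    [M / e] is a class of points on a line through [e]. If all classes have at least
    [c] points, then either on some large subspace no contraction of a point
    produces a class of more than [c] points, and then the span in [M] of a lift of
    a basis meets every class, so it is a projective geometry avoiding [e]; or such
    enlargements exist in each summand of a large direct sum, and contracting onto
    a quotient in which these summands supply every point makes all classes have
    at least [c+1] points. Once [c] reaches q^2, a class together with [e] is a line
    with q^2+1 points. *)

(** * Contraction, roundness and line minors *)

Ltac seteq := let t := fresh in apply/setP => t; rewrite !inE; btauto.
Ltac setsub :=
  let t := fresh in
  apply/subsetP => t; rewrite !inE; apply/implyP; rewrite implybE /is_true; btauto.

(** Submodularity for [Y] and [X :|: Z], whose intersection contains [X]: adding [Z] gains no more
    rank over the larger set. *)
Lemma rk_submod_le (T : finType) (M : matroid T) (X Y Z : {set T}) :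
  X \subset Y -> rk M (Y :|: Z) + rk M X <= rk M Y + rk M (X :|: Z).
Proof.
move=> sXY; have := rk_submod M Y (X :|: Z).
rewrite setUA (setUidPl sXY) => h; apply: leq_trans h.
by rewrite leq_add2l rk_mono // subsetI sXY subsetUl.
Qed.

Lemma rkU_id (T : finType) (M : matroid T) (X Y Z : {set T}) :
  X \subset Y -> rk M (X :|: Z) = rk M X -> rk M (Y :|: Z) = rk M Y.
Proof.
move=> /(rk_submod_le M Z) h e.
by have := rk_mono M (subsetUl Y Z); lia.
Qed.

Lemma rkU_le (T : finType) (M : matroid T) (X Z : {set T}) :
  rk M (X :|: Z) <= rk M X + rk M Z.
Proof. by have := rk_submod_le M Z (sub0set X); rewrite set0U; lia. Qed.

Lemma rkU_closure (T : finType) (M : matroid T) (I S : {set T}) :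
  {in S, forall x, rk M (I :|: [set x]) = rk M I} -> rk M (I :|: S) = rk M I.
Proof.
move: {2}#|S| (erefl #|S|) => n; elim: n S => [|n IH] S cS clS.
  by rewrite (cards0_eq cS) setU0.
have /card_gt0P[x xS] : 0 < #|S| by rewrite cS.
have rI : rk M (I :|: S :\ x) = rk M I.
  apply: IH => [|y /setD1P[_ /clS] //].
  by move: cS; rewrite (cardsD1 x S) xS => -[].
by rewrite -(setD1K xS) setUA (rkU_id (subsetUl I [set x]) rI) clS.
Qed.

Lemma rk0 (T : finType) (M : matroid T) : rk M set0 = 0.
Proof. by have := rk_card M set0; rewrite cards0; lia. Qed.

Lemma rk1_le (T : finType) (M : matroid T) (x : T) : rk M [set x] <= 1.
Proof. by have := rk_card M [set x]; rewrite cards1. Qed.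

Definition contract_rk (T : finType) (M : matroid T) (C X : {set T}) : nat :=
  rk M (X :|: C) - rk M C.

Lemma contract_rk_ground (T : finType) (M : matroid T) (C X : {set T}) :
  contract_rk M C X = contract_rk M C (X :&: ground M).
Proof.
by congr (_ - _); rewrite rk_ground [RHS]rk_ground; congr (rk M _); seteq.
Qed.

Lemma contract_rk_card (T : finType) (M : matroid T) (C X : {set T}) :
  contract_rk M C X <= #|X|.
Proof.
rewrite /contract_rk setUC.
by have := rkU_le M C X; have := rk_card M X; lia.
Qed.

Lemma contract_rk_mono (T : finType) (M : matroid T) (C X Y : {set T}) :
  X \subset Y -> contract_rk M C X <= contract_rk M C Y.
Proof. by move=> sXY; apply/leq_sub2r/rk_mono/setSU. Qed.

Lemma contract_rk_submod (T : finType) (M : matroid T) (C X Y : {set T}) :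
  contract_rk M C (X :|: Y) + contract_rk M C (X :&: Y)
    <= contract_rk M C X + contract_rk M C Y.
Proof.
rewrite /contract_rk; have := rk_submod M (X :|: C) (Y :|: C).
rewrite (_ : _ :|: C :|: _ = X :|: Y :|: C); last by seteq.
rewrite (_ : (X :|: C) :&: _ = X :&: Y :|: C); last by seteq.
have := rk_mono M (subsetUr (X :&: Y) C); have := rk_mono M (subsetUr (X :|: Y) C).
by have := rk_mono M (subsetUr X C); have := rk_mono M (subsetUr Y C); lia.
Qed.

(* The ground set is not shrunk: the elements of [C] become loops. *)
Definition contract (T : finType) (M : matroid T) (C : {set T}) : matroid T :=
  Matroid (contract_rk_ground M C) (contract_rk_card M C)
    (@contract_rk_mono T M C) (contract_rk_submod M C).

Lemma rk_contract (T : finType) (M : matroid T) (C X : {set T}) :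
  rk (contract M C) X + rk M C = rk M (X :|: C).
Proof. by rewrite /= /contract_rk subnK // rk_mono // subsetUr. Qed.

Lemma rk_contract2 (T : finType) (M : matroid T) (C D X : {set T}) :
  rk (contract (contract M C) D) X = rk (contract M (C :|: D)) X.
Proof.
have := rk_contract (contract M C) D X; have := rk_contract M C (X :|: D).
have := rk_contract M C D; have := rk_contract M (C :|: D) X.
by rewrite (setUC D) -setUA (setUC D); lia.
Qed.

Lemma rk_contractC (T : finType) (M : matroid T) (C D X : {set T}) :
  rk (contract (contract M C) D) X = rk (contract (contract M D) C) X.
Proof. by rewrite !rk_contract2 setUC. Qed.

(** A largest independent set between [J] and [S] has every element of [S] in its closure, since
    otherwise one more could be added. *)
Lemma extend_indep (T : finType) (M : matroid T) (J S : {set T}) :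
  J \subset S -> rk M J = #|J| ->
  exists I : {set T}, [/\ J \subset I, I \subset S, rk M I = #|I| & rk M I = rk M S].
Proof.
move=> sJS rJ; pose P (I : {set T}) := [&& J \subset I, I \subset S & rk M I == #|I|].
have P0 : P J by rewrite /P subxx sJS rJ eqxx.
case: (@arg_maxnP _ J P (fun I => #|I|) P0) => I /and3P[sJI sIS /eqP rI] max_I.
exists I; split=> //; apply/eqP; rewrite eqn_leq rk_mono //=.
have closed x : x \in S -> rk M (I :|: [set x]) = rk M I.
  move=> xS; have := rk_mono M (subsetUl I [set x]); have := rkU_le M I [set x].
  have := rk1_le M x => h1 h2 h3.
  have [xI|xI] := boolP (x \in I); first by rewrite (setUidPl _) // sub1set.
  apply/eqP; apply: contraT => ne.
  have /max_I : P (x |: I).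
    rewrite /P (subset_trans sJI) ?subsetUr //= subUset sub1set xS sIS /=.
    by rewrite cardsU1 xI add1n; apply/eqP; move: ne h1 h2 h3; rewrite setUC rI; lia.
  by move=> /=; rewrite cardsU1 xI; lia.
by rewrite -[X in rk M X <= _](setUidPr sIS) rkU_closure.
Qed.

(** * Roundness and lines under contraction *)

(** Covers of the whole type replace partitions of the ground set. Contracted elements stay as
    loops, so in this form roundness passes to contractions: add [C] to both sides of a cover. *)
Definition round_cover (T : finType) (M : matroid T) : Prop :=
  forall X Y : {set T}, X :|: Y = [set: T] ->
    rk M X = rk M [set: T] \/ rk M Y = rk M [set: T].

Lemma round_cover_of_round (T : finType) (M : matroid T) : round M -> round_cover M.
Proof.
move=> rM X Y XY.
have eT : rk M [set: T] = mrank M by rewrite rk_ground setTI.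
have [hX|hX] := eqVneq (rk M X) (rk M [set: T]); first by left.
have [hY|hY] := eqVneq (rk M Y) (rk M [set: T]); first by right.
case: rM; exists (X :&: ground M), (ground M :\: X).
have hXT := rk_mono M (subsetT X); have hYT := rk_mono M (subsetT Y).
split; first by seteq.
- by rewrite -setI_eq0; apply/eqP; seteq.
- by rewrite -rk_ground -eT; lia.
- apply: (@leq_ltn_trans (rk M Y)); last by rewrite -eT; lia.
  apply: rk_mono; apply/subsetP=> x; rewrite inE => /andP[xX _].
  by have := in_setT x; rewrite -XY inE (negPf xX).
Qed.

Lemma round_cover_contract (T : finType) (M : matroid T) (C : {set T}) :
  round_cover M -> round_cover (contract M C).
Proof.
move=> rM X Y XY; have := rk_contract M C X; have := rk_contract M C Y.
have := rk_contract M C [set: T]; rewrite (setUidPl (subsetT _)) => hT hY hX.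
have : (X :|: C) :|: (Y :|: C) = [set: T].
  by apply/eqP; rewrite -subTset -XY; setsub.
by case/rM => h; [left | right]; lia.
Qed.

Definition line (T : finType) (M : matroid T) (m : nat) (L : {set T}) : Prop :=
  [/\ #|L| = m, rk M L = 2 &
      {in L &, forall x y, x != y -> rk M [set x; y] = 2}].

(** Deletions are absorbed in the choice of [L], so only the contracted elements are recorded. *)
Definition line_minor (T : finType) (M : matroid T) (m : nat) : Prop :=
  exists C L : {set T}, line (contract M C) m L.

Lemma line_ext (T : finType) (M N : matroid T) (m : nat) (L : {set T}) :
  rk M =1 rk N -> line M m L -> line N m L.
Proof. by move=> e [cL rL pL]; split=> // [|x y xL yL /pL]; rewrite -e //; apply. Qed.

Lemma line_minor_contract (T : finType) (M : matroid T) (m : nat) (C : {set T}) :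
  line_minor (contract M C) m -> line_minor M m.
Proof.
case=> D [L hL]; exists (C :|: D), L; apply: line_ext hL => X.
exact: rk_contract2.
Qed.

(** The hypothesis encodes in one equation that [I] is independent and skew to [L]; submodularity
    passes this on to parts of [L]. *)
Lemma rk_skew_sub (T : finType) (M : matroid T) (L I X : {set T}) :
  rk M (L :|: I) = rk M L + #|I| -> X \subset L -> rk M (X :|: I) = rk M X + #|I|.
Proof.
move=> h /(rk_submod_le M I); have := rkU_le M X I; have := rk_card M I; lia.
Qed.

Lemma line_contract (T : finType) (M : matroid T) (m : nat) (L I : {set T}) :
  line M m L -> rk M (L :|: I) = rk M L + #|I| -> line (contract M I) m L.
Proof.
move=> [cL rL pL] h; have rI := rk_skew_sub h (sub0set L).
rewrite set0U rk0 add0n in rI; split=> // [|x y xL yL xy].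
  by have := rk_contract M I L; lia.
have := rk_contract M I [set x; y]; rewrite (rk_skew_sub h) ?pL // ?rI; first by lia.
by rewrite subUset !sub1set xL.
Qed.

(** * Projective geometries in a matroid *)

Definition vspan (F : finFieldType) (V : vectType F) (T : finType) (phi : T -> V)
    (X : {set T}) : {vspace V} := (\sum_(x in X) <[phi x]>)%VS.

Lemma vspan_subP (F : finFieldType) (V : vectType F) (T : finType) (phi : T -> V)
    (X : {set T}) (U : {vspace V}) :
  reflect {in X, forall x, phi x \in U} (vspan phi X <= U)%VS.
Proof. exact: subv_sumP. Qed.

Lemma mem_vspan (F : finFieldType) (V : vectType F) (T : finType) (phi : T -> V)
    (X : {set T}) (x : T) : x \in X -> phi x \in vspan phi X.
Proof. by move: x; apply/vspan_subP. Qed.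

Lemma vspanS (F : finFieldType) (V : vectType F) (T : finType) (phi : T -> V)
    (X Y : {set T}) : X \subset Y -> (vspan phi X <= vspan phi Y)%VS.
Proof. by move/subsetP=> sXY; apply/vspan_subP => x /sXY; apply: mem_vspan. Qed.

Lemma vspanU (F : finFieldType) (V : vectType F) (T : finType) (phi : T -> V)
    (X Y : {set T}) : vspan phi (X :|: Y) = (vspan phi X + vspan phi Y)%VS.
Proof.
apply/eqP; rewrite eqEsubv subv_add !vspanS ?subsetUl ?subsetUr // !andbT.
apply/vspan_subP => x; rewrite inE => /orP[] /(mem_vspan phi); apply: subvP.
  exact: addvSl.
exact: addvSr.
Qed.

Lemma vspan1 (F : finFieldType) (V : vectType F) (T : finType) (phi : T -> V) (x : T) :
  vspan phi [set x] = <[phi x]>%VS.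
Proof. by rewrite /vspan big_set1. Qed.

Lemma vspan2 (F : finFieldType) (V : vectType F) (T : finType) (phi : T -> V) (x y : T) :
  vspan phi [set x; y] = (<[phi x]> + <[phi y]>)%VS.
Proof. by rewrite vspanU !vspan1. Qed.

Lemma limg_vspan (F : finFieldType) (V W : vectType F) (f : 'Hom(V, W)) (T : finType)
    (phi : T -> V) (X : {set T}) : (f @: vspan phi X)%VS = vspan (f \o phi) X.
Proof. by rewrite /vspan limg_sum; apply: eq_bigr => x _; rewrite limg_line. Qed.

Lemma dim_vline_add (F : finFieldType) (V : vectType F) (v : V) (U : {vspace V}) :
  v \notin U -> \dim (<[v]> + U)%VS = (\dim U).+1.
Proof.
move=> vU; rewrite dimv_disjoint_sum ?dim_vline; 
  first by case: eqP vU => [->|]; rewrite ?mem0v.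
apply/eqP; rewrite -subv0; apply/subvP => w /memv_capP[/vlineP[k ->] kvU].
have [->|k0] := eqVneq k 0%R; first by rewrite scale0r mem0v.
by case/negP: vU; rewrite -[v](scalerK k0) memvZ.
Qed.

Lemma vline_eq (F : finFieldType) (V : vectType F) (v w : V) :
  v != 0%R -> v \in <[w]>%VS -> <[v]>%VS = <[w]>%VS.
Proof.
by move=> v0 vw; apply/eqP; rewrite eqEdim -memvE vw !dim_vline v0 leq_b1.
Qed.

(** The quotient is realised as a complement of [U], with the projection along [U]. *)
Lemma quotient_map (F : finFieldType) (V : vectType F) (U : {vspace V}) :
  exists (W : vectType F) (f : 'Hom(V, W)), lker f = U /\ limg f = fullv.
Proof.
pose pi := daddv_pi (U^C)%VS U.
have cap0 : (U :&: U^C = 0)%VS by exact: capv_compl.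
have dec w : (daddv_pi U (U^C)%VS w + pi w = w)%R.
  by apply: daddv_pi_add => //; rewrite addv_complf memvf.
exists (subvs_of (U^C)%VS), (linfun (vsproj (U^C)%VS \o pi)); split.
  apply/vspaceP => w; rewrite memv_ker lfunE /=.
  apply/eqP/idP => [/(congr1 vsval)|wU].
    rewrite vsprojK ?memv_pi // linear0 => pw0.
    by rewrite -(dec w) pw0 addr0 memv_pi.
  have := dec w; rewrite daddv_pi_id // => /(canRL (addKr _)).
  by rewrite addNr => ->; rewrite linear0.
apply/vspaceP => w; rewrite memvf; apply/memv_imgP; exists (vsval w); first exact: memvf.
by rewrite lfunE /= daddv_pi_id ?subvsP ?vsvalK // capvC.
Qed.

(* [A] carries a projective geometry in [M], up to loops and parallel elements. *)
Definition pg_rep (F : finFieldType) (V : vectType F) (T : finType) (M : matroid T)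
    (A : {set T}) (phi : T -> V) : Prop :=
  (forall X : {set T}, X \subset A -> rk M X = \dim (vspan phi X)) /\
  (forall v : V, v != 0%R -> exists2 x, x \in A & <[phi x]>%VS = <[v]>%VS).

Lemma pg_rep_ext (F : finFieldType) (V : vectType F) (T : finType) (M N : matroid T)
    (A : {set T}) (phi : T -> V) : rk M =1 rk N -> pg_rep M A phi -> pg_rep N A phi.
Proof. by move=> e [h1 h2]; split=> // X /h1; rewrite e. Qed.

Definition flat (F : finFieldType) (V : vectType F) (T : finType) (A : {set T})
    (phi : T -> V) (U : {vspace V}) : {set T} := [set x in A | phi x \in U].

Lemma flat_sub (F : finFieldType) (V : vectType F) (T : finType) (A : {set T})
    (phi : T -> V) (U : {vspace V}) : flat A phi U \subset A.
Proof. by apply/subsetP => x; rewrite inE => /andP[]. Qed.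

Lemma vspan_flat (F : finFieldType) (V : vectType F) (T : finType) (M : matroid T)
    (A : {set T}) (phi : T -> V) (U : {vspace V}) :
  pg_rep M A phi -> vspan phi (flat A phi U) = U.
Proof.
move=> [_ cov]; apply/eqP; rewrite eqEsubv; apply/andP; split.
  by apply/vspan_subP => x; rewrite inE => /andP[].
apply/subvP => v vU; have [->|/cov[x xA ex]] := eqVneq v 0%R; first exact: mem0v.
have : (<[phi x]> <= U)%VS by rewrite ex -memvE.
rewrite memvE -ex => pU; rewrite -memvE; apply: mem_vspan.
by rewrite inE xA memvE.
Qed.

Lemma rk_flat (F : finFieldType) (V : vectType F) (T : finType) (M : matroid T)
    (A : {set T}) (phi : T -> V) (U : {vspace V}) :
  pg_rep M A phi -> rk M (flat A phi U) = \dim U.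
Proof. by move=> rep; rewrite rep.1 ?flat_sub // (vspan_flat _ rep). Qed.

Lemma rk_pg_rep (F : finFieldType) (V : vectType F) (T : finType) (M : matroid T)
    (A : {set T}) (phi : T -> V) : pg_rep M A phi -> rk M A = \dim {:V}.
Proof.
move=> rep; rewrite -(rk_flat _ rep); congr (rk M _).
by apply/setP => x; rewrite inE memvf andbT.
Qed.

Lemma sub_flat (F : finFieldType) (V : vectType F) (T : finType) (A X : {set T})
    (phi : T -> V) (U : {vspace V}) :
  X \subset A -> (vspan phi X <= U)%VS -> X \subset flat A phi U.
Proof.
move=> /subsetP sXA /vspan_subP sXU; apply/subsetP => x xX.
by rewrite inE sXA // sXU.
Qed.

(** Contracting a set that spans the kernel of [f] amounts to passing to the quotient: the rank left
    over is the dimension of the image under [f]. *)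
Lemma pg_rep_contract (F : finFieldType) (V W : vectType F) (f : 'Hom(V, W))
    (T : finType) (M : matroid T) (A I : {set T}) (phi : T -> V) :
  pg_rep M A phi -> I \subset A -> vspan phi I = lker f -> limg f = fullv ->
  pg_rep (contract M I) A (f \o phi).
Proof.
move=> [rkA cov] sIA kI imf; split=> [X sXA|w w0].
  have := rk_contract M I X; rewrite rkA ?rkA ?subUset ?sXA // vspanU kI.
  rewrite -limg_vspan => h.
  have := limg_ker_dim f (vspan phi X + lker f).
  rewrite (capv_idPr _) ?addvSr // limgD.
  have -> : (f @: lker f)%VS = 0%VS by apply/eqP; rewrite -lkerE.
  by rewrite addv0; lia.
have /memv_imgP[v _ ew] : w \in limg f by rewrite imf memvf.
have /cov[x xA ex] : v != 0%R by apply: contraNneq w0 => v0; rewrite ew v0 linear0.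
by exists x; rewrite //= -!limg_line ex limg_line ew.
Qed.

(** [f] embeds [W] as a subspace; the elements lying in it get coordinates in [W] through the
    inverse of [f]. *)
Lemma pg_rep_sub (F : finFieldType) (V W : vectType F) (f : 'Hom(W, V))
    (T : finType) (M : matroid T) (A : {set T}) (phi : T -> V) :
  pg_rep M A phi -> lker f = 0%VS ->
  pg_rep M (flat A phi (limg f)) (f^-1%VF \o phi).
Proof.
move=> [rkA cov] kf; split=> [X sXA|w w0].
  rewrite rkA ?(subset_trans sXA) ?flat_sub // -limg_vspan.
  have e : vspan phi X = (f @: (f^-1%VF @: vspan phi X))%VS.
    rewrite -limg_comp -{1}[vspan phi X]lim1g; apply: eq_in_limg => v vX.
    rewrite id_lfunE comp_lfunE limg_lfunVK //; apply: subvP vX; apply/vspan_subP.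
    by move=> x /(subsetP sXA); rewrite inE => /andP[].
  by rewrite {1}e limg_dim_eq // kf capv0.
have fw0 : f w != 0%R by rewrite -memv_ker kf memv0.
have [x xA ex] := cov _ fw0; exists x.
  by rewrite inE xA memvE ex -memvE memv_img ?memvf.
by rewrite /= -limg_line ex limg_line lker0_lfunK // kf.
Qed.

(** The element [z] need not lie in [A]. Dimensions of subspaces are modular, so once [z] raises the
    rank of neither flat, submodularity leaves no room for it to raise that of the intersection. *)
Lemma pg_rep_modular (F : finFieldType) (V : vectType F) (T : finType) (M : matroid T)
    (A : {set T}) (phi : T -> V) (z : T) (U W : {vspace V}) :
  pg_rep M A phi ->
  rk M (flat A phi U :|: [set z]) = \dim U -> rk M (flat A phi W :|: [set z]) = \dim W ->
  rk M (flat A phi (U :&: W)%VS :|: [set z]) = \dim (U :&: W)%VS.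
Proof.
move=> rep rU rW.
have := rk_submod M (flat A phi U :|: [set z]) (flat A phi W :|: [set z]).
have : rk M (flat A phi U :|: flat A phi W) = \dim (U + W).
  by rewrite rep.1 ?subUset ?flat_sub // vspanU !(vspan_flat _ rep).
have : rk M (flat A phi U :|: flat A phi W) <=
       rk M (flat A phi U :|: [set z] :|: (flat A phi W :|: [set z])).
  by apply: rk_mono; setsub.
have -> : (flat A phi U :|: [set z]) :&: (flat A phi W :|: [set z]) =
          flat A phi (U :&: W)%VS :|: [set z].
  apply/setP => x; rewrite !inE; case: (x == z); rewrite ?orbT ?orbF //.
  by case: (x \in A); rewrite //= memv_cap.
have := rk_mono M (subsetUl (flat A phi (U :&: W)%VS) [set z]).
rewrite (rk_flat _ rep); have := dimv_sum_cap U W; lia.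
Qed.

Lemma rk_flatU (F : finFieldType) (V : vectType F) (T : finType) (M : matroid T)
    (A X Z : {set T}) (phi : T -> V) :
  pg_rep M A phi -> X \subset A ->
  (rk M (X :|: Z) == rk M X) = (rk M (flat A phi (vspan phi X) :|: Z) == rk M X).
Proof.
move=> rep sXA; have sXf := sub_flat sXA (subvv (vspan phi X)).
have rf : rk M (flat A phi (vspan phi X)) = rk M X by rewrite (rk_flat _ rep) rep.1.
apply/eqP/eqP => [h|h]; first by rewrite (rkU_id sXf h).
have := rk_mono M (subsetUl X Z); have := rk_mono M (setSU Z sXf); lia.
Qed.

Definition unparallel (T : finType) (M : matroid T) (A : {set T}) (z : T) : Prop :=
  {in A, forall x, rk M [set x] = 1 -> rk M [set x; z] = 2}.

Lemma pg_rep_pair (F : finFieldType) (V : vectType F) (T : finType) (M : matroid T)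
    (A : {set T}) (phi : T -> V) (D : {vspace V}) :
  pg_rep M A phi -> \dim D = 2 ->
  exists x y, [/\ x \in A, y \in A, vspan phi [set x; y] = D & rk M [set x; y] = 2].
Proof.
move=> rep dD; have [u uD u0] : exists2 u, u \in D & u != 0%R.
  exists (vpick D); first exact: memv_pick.
  by rewrite vpick0 -dimv_eq0 dD.
have [v vD vu] : exists2 v, v \in D & v \notin <[u]>%VS.
  apply/subvPn; apply: contraTN isT => /dimvS; rewrite dD dim_vline; lia.
have v0 : v != 0%R by apply: contraNneq vu => ->; rewrite mem0v.
have [[x xA ex] [y yA ey]] := (rep.2 _ u0, rep.2 _ v0).
have eD : vspan phi [set x; y] = D.
  rewrite vspan2 ex ey; apply/eqP; rewrite eqEdim addvC dim_vline_add // dim_vline u0 dD.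
  by rewrite subv_add -!memvE uD vD.
by exists x, y; split=> //; rewrite rep.1 ?eD // subUset !sub1set xA.
Qed.

(* Two 2-dimensional subspaces spanning [z] would meet in a flat of rank at most
   one spanning [z]. *)
Lemma unique_plane (F : finFieldType) (V : vectType F) (T : finType) (M : matroid T)
    (A : {set T}) (phi : T -> V) (z : T) :
  pg_rep M A phi -> unparallel M A z -> 2 <= \dim {:V} ->
  exists2 U : {vspace V}, \dim U = 2 &
    forall D : {vspace V}, \dim D = 2 -> rk M (flat A phi D :|: [set z]) = 2 -> D = U.
Proof.
move=> rep spr dV.
have uniq (D E : {vspace V}) : \dim D = 2 -> \dim E = 2 ->
    rk M (flat A phi D :|: [set z]) = 2 -> rk M (flat A phi E :|: [set z]) = 2 -> D = E.
  move=> dD dE rD rE; apply/eqP; apply: contraT => DE.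
  have := pg_rep_modular rep (etrans rD (esym dD)) (etrans rE (esym dE)).
  set G := (D :&: E)%VS => rG.
  have dG : \dim G <= 1.
    have := dimv_sum_cap D E; have : \dim D < \dim (D + E).
      rewrite ltnNge; apply: contra DE => h.
      have /eqP eDE : D == (D + E)%VS by rewrite eqEdim addvSl.
      by rewrite eq_sym eqEdim dD dE leqnn andbT eDE addvSr.
    by rewrite -/G; lia.
  (* If [G] is zero, any nonzero vector serves; in both cases a single point of the geometry spans
     [z]. *)
  have [w w0 Gw] : exists2 w : V, w != 0%R & (G <= <[w]>)%VS.
    have [G0|G0] := eqVneq G 0%VS.
      exists (vpick fullv); last by rewrite G0 sub0v.
      by rewrite vpick0 -dimv_eq0 -lt0n (ltn_trans _ dV).
    exists (vpick G); first by rewrite vpick0.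
    have /eqP-> : <[vpick G]>%VS == G; last exact: subvv.
    by rewrite eqEdim -memvE memv_pick dim_vline vpick0 G0.
  have [x xA ex] := rep.2 w w0.
  have rx : rk M [set x] = 1 by rewrite rep.1 ?sub1set // vspan1 ex dim_vline w0.
  have sGx : flat A phi G \subset flat A phi (vspan phi [set x]).
    by apply/subsetP => y; rewrite !inE vspan1 ex => /andP[-> /(subvP Gw)].
  have /eqP := rkU_id sGx (etrans rG (esym (rk_flat _ rep))).
  rewrite (rk_flat _ rep) -rep.1 ?sub1set // -rk_flatU ?sub1set // rx spr //.
(* Either two points of [A] span [z] and [U] is their span, or no 2-dimensional subspace spans [z]
   and any choice of [U] works. *)
have [/existsP[x /existsP[y /and4P[xA yA rxy rz]]]|no] := boolP [exists x, exists y,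
    [&& x \in A, y \in A, rk M [set x; y] == 2 & rk M ([set x; y] :|: [set z]) == 2]].
  have sxy : [set x; y] \subset A by rewrite subUset !sub1set xA.
  have dU : \dim (vspan phi [set x; y]) = 2 by rewrite -rep.1 //; apply/eqP.
  exists (vspan phi [set x; y]) => // D dD rD; apply: uniq => //; apply/eqP.
  by rewrite -(eqP rxy) -rk_flatU // (eqP rxy).
have [U dU] : exists U : {vspace V}, \dim U = 2.
  pose X := take 2 (vbasis {:V}); exists <<X>>%VS.
  have : free (X ++ drop 2 (vbasis {:V})) by rewrite cat_take_drop (basis_free (vbasisP _)).
  move/catl_free/eqP ->; rewrite size_takel // size_tuple //.
exists U => // D dD rD; have [x [y [xA yA eD rxy]]] := pg_rep_pair rep dD.
case/negP: no; apply/existsP; exists x; apply/existsP; exists y.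
have sxy : [set x; y] \subset A by rewrite subUset !sub1set xA.
by have := rk_flatU [set z] rep sxy; rewrite eD rD rxy xA yA eqxx => ->.
Qed.

(** * A spanning geometry and a point or a long line off it *)

Lemma dim_vline_pair (F : finFieldType) (V : vectType F) (u v : V) :
  \dim (<[u]> + <[v]>)%VS = 2 -> u != 0%R /\ v \notin <[u]>%VS.
Proof.
move=> d2; split.
  by apply: contra_eqN d2 => /eqP->; rewrite add0v dim_vline; lia.
by apply: contra_eqN d2 => vu; rewrite (addv_idPl _) -?memvE // dim_vline; lia.
Qed.

Lemma line_of_family (T : finType) (M : matroid T) (J : finType) (y : J -> T) :
  1 < #|J| -> rk M (y @: [set: J]) <= 2 ->
  (forall i j, i != j -> rk M [set y i; y j] = 2) -> line M #|J| (y @: [set: J]).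
Proof.
move=> cJ rY pair.
have inj : injective y.
  move=> i j eij; apply/eqP; apply: contraT => /pair.
  by rewrite eij setUid; have := rk1_le M (y j); lia.
split; first by rewrite card_imset // cardsT.
  apply/eqP; rewrite eqn_leq rY /=; have [i [j [_ _ ij]]] := card_gt1P cJ.
  by rewrite -(pair _ _ ij) rk_mono // subUset !sub1set !imset_f.
move=> _ _ /imsetP[i _ ->] /imsetP[j _ ->] ij; apply: pair.
by apply: contraNneq ij => ->.
Qed.

(** Contract [z]. Only the line [U] of the geometry can span [z], so the q^2 points off [U] and one
    point of [U] stay pairwise independent: any two of them span a line other than [U]. *)
Lemma line_minor_plane (F : finFieldType) (V : vectType F) (T : finType)
    (M : matroid T) (A : {set T}) (phi : T -> V) (z : T) :
  pg_rep M A phi -> \dim {:V} = 3 -> unparallel M A z -> rk M (A :|: [set z]) = rk M A ->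
  line_minor M (#|F| ^ 2 + 1).
Proof.
move=> rep dV spr zA; have rA := rk_pg_rep rep.
have [|U dU uniq] := unique_plane rep spr; first by rewrite dV.
have [u1 [u2 [u1A u2A eU r12]]] := pg_rep_pair rep dU.
have [w _ wU] : exists2 w, w \in fullv & w \notin U.
  by apply/subvPn; apply: contraTN isT => /dimvS; rewrite dU dV.
rewrite vspan2 in eU; set v1 := phi u1 in eU; set v2 := phi u2 in eU.
have v1U : v1 \in U by rewrite -eU (subvP (addvSl _ _)) ?memv_line.
have v2U : v2 \in U by rewrite -eU (subvP (addvSr _ _)) ?memv_line.
have [v10 v21] : v1 != 0%R /\ v2 \notin <[v1]>%VS.
  by apply: dim_vline_pair; rewrite eU.
(* [Some (a, b)] runs through the q^2 points off [U]; [None] is the point of [U]. *)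
pose vec (o : option (F * F)) : V :=
  if o is Some (a, b) then (w + (a *: v1 + b *: v2))%R else v1.
have vecU a b : vec (Some (a, b)) \notin U.
  by apply: contra wU => h; rewrite -[w](addrK (a *: v1 + b *: v2)%R) memvB // memvD ?memvZ.
have vec0 o : vec o != 0%R.
  case: o => [[a b]|//]; apply: contraNneq (vecU a b) => ->; exact: mem0v.
have vecD a b o : Some (a, b) != o -> vec (Some (a, b)) \notin <[vec o]>%VS.
  apply: contra => /vlineP[k]; case: o => [[c d]|] e; last first.
    by case/negP: (vecU a b); rewrite e memvZ.
  have k1 : k = 1%R.
    apply/eqP; apply: contraNT wU => k1.
    have k1' : (1 - k != 0)%R by rewrite subr_eq0 eq_sym.
    rewrite -[w](scalerK k1') memvZ // scalerBl scale1r.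
    have -> : (w - k *: w = k *: (c *: v1 + d *: v2) - (a *: v1 + b *: v2))%R.
      rewrite /vec scalerDr in e; apply/eqP.
      by rewrite subr_eq addrAC (addrC _ (k *: w)%R) -e addrK.
    by rewrite memvB ?memvZ ?memvD ?memvZ.
  move: e; rewrite k1 scale1r /vec => /addrI.
  have [->|bd] := eqVneq b d; first by
    move/addIr/eqP; rewrite -subr_eq0 -scalerBl
      scaler_eq0 (negPf v10) orbF subr_eq0 => /eqP->.
  move=> e; case/negP: v21; have bd' : (b - d != 0)%R by rewrite subr_eq0.
  rewrite -[v2](scalerK bd') memvZ // scalerBl; apply/vlineP; exists (c - a)%R.
  rewrite scalerBl; apply/eqP.
  by rewrite subr_eq addrAC -e (addrC (a *: v1)%R) addrK.
have [y yA ey] := fin_all_exists2 (fun o => rep.2 _ (vec0 o)).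
have pair3 a b o : Some (a, b) != o ->
    rk M ([set y (Some (a, b)); y o] :|: [set z]) = 3.
  move=> /vecD nab; set p := Some _.
  have sA : [set y p; y o] \subset A by rewrite subUset !sub1set !yA.
  have dD : \dim (vspan phi [set y p; y o]) = 2.
    by rewrite vspan2 !ey dim_vline_add // dim_vline vec0.
  have r2 : rk M [set y p; y o] = 2 by rewrite rep.1.
  have := rkU_le M [set y p; y o] [set z]; have := rk1_le M z.
  have := rk_mono M (subsetUl [set y p; y o] [set z]); rewrite r2.
  have := rk_flatU [set z] rep sA; rewrite r2.
  have [|_ /negbT h0 h1 h2 h3] := eqVneq (rk M (flat _ _ _ :|: _)) 2; last by lia.
  move/(uniq _ dD) => eD; case/negP: (vecU a b).
  by rewrite -eD vspan2 (subvP (addvSl _ _)) // ey memv_line.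
(* [z] is not a loop, since it raises the rank of a pair to 3. *)
have rz : rk M [set z] = 1.
  have := pair3 0%R 0%R None isT; have := rk1_le M z.
  have := rkU_le M [set y (Some (0%R, 0%R)); y None] [set z].
  have := rk_card M [set y (Some (0%R, 0%R)); y None].
  by rewrite cards2; case: (_ != _) => /=; lia.
have -> : #|F| ^ 2 + 1 = #|{: option (F * F)}| by rewrite card_option card_prod addn1 mulnn.
exists [set z], (y @: [set: option (F * F)]); apply: line_of_family.
- have : 0 < #|F| by apply/card_gt0P; exists 0%R.
  by rewrite card_option card_prod ltnS muln_gt0 => ->.
- apply: (@leq_trans (rk (contract M [set z]) A)).
    by apply/rk_mono/subsetP => _ /imsetP[o _ ->].
  by have := rk_contract M [set z] A; rewrite zA rA dV rz; lia.
- move=> i j ij; have := rk_contract M [set z] [set y i; y j]; rewrite rz.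
  have -> : rk M ([set y i; y j] :|: [set z]) = 3; last by lia.
  case: i ij => [[a b]|] ij; first exact: pair3.
  by case: j ij => [[a b]|//] _; rewrite (setUC [set y None]) pair3.
Qed.

(** Induction on the dimension: contract a point [a] off the only line [U] that may span [z]. If
    some [x] became parallel to [z], the line through [x] and [a] would span [z], hence be [U],
    which misses [a]. *)
Lemma line_minor_spanned (F : finFieldType) (V : vectType F) (T : finType)
    (M : matroid T) (A : {set T}) (phi : T -> V) (z : T) :
  pg_rep M A phi -> 3 <= \dim {:V} -> unparallel M A z ->
  rk M (A :|: [set z]) = rk M A -> line_minor M (#|F| ^ 2 + 1).
Proof.
move en : (\dim {:V} - 3) => n; elim: n V M phi en => [|n IH] V M phi en rep dV spr zA.
  by apply: line_minor_plane rep _ spr zA; lia.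
have [|U dU uniq] := unique_plane rep spr; first by apply: leq_trans dV.
have [v _ vU] : exists2 v, v \in fullv & v \notin U.
  by apply/subvPn; apply: contraTN isT => /dimvS; rewrite dU leqNgt dV.
have v0 : v != 0%R by apply: contraNneq vU => ->; rewrite mem0v.
have [a aA ea] := rep.2 _ v0.
have ra : rk M [set a] = 1 by rewrite rep.1 ?sub1set // vspan1 ea dim_vline v0.
have [W [f [kf imf]]] := quotient_map <[phi a]>%VS.
have saA : [set a] \subset A by rewrite sub1set.
have repW : pg_rep (contract M [set a]) A (f \o phi).
  by apply: pg_rep_contract => //; rewrite vspan1.
have dW : \dim {:W} + 1 = \dim {:V}.
  have := limg_ker_dim f fullv; rewrite capfv kf imf ea dim_vline v0; lia.
apply: (@line_minor_contract _ _ _ [set a]); apply: IH repW _ _ _; try lia.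
  move=> x xA; have := rk_contract M [set a] [set x].
  have := rk_contract M [set a] [set x; z]; rewrite ra => h1 h2 h3.
  have r2 : rk M ([set x] :|: [set a]) = 2 by lia.
  have sA : [set x; a] \subset A by rewrite subUset !sub1set xA aA.
  have := rk_flatU [set z] rep sA; rewrite r2.
  have e : [set x; z] :|: [set a] = [set x; a] :|: [set z] by seteq.
  rewrite e in h1; have := rk_mono M (subsetUl [set x; a] [set z]); rewrite r2.
  have := rkU_le M [set x; a] [set z]; have := rk1_le M z; rewrite r2.
  have dD : \dim (vspan phi [set x; a]) = 2 by rewrite -rep.1.
  have [|_ h4 h5 h6 /negbT h7] := eqVneq (rk M (flat _ _ _ :|: _)) 2; last by lia.
  move/(uniq _ dD) => eD; case/negP: vU.
  by rewrite -eD vspan2 (subvP (addvSr _ _)) // ea memv_line.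
have := rk_contract M [set a] (A :|: [set z]); have := rk_contract M [set a] A.
rewrite setUAC (setUidPl saA) zA; lia.
Qed.

(* Relative to two of them, pairwise independent vectors of a plane have distinct slopes. *)
Lemma card_pairwise_indep (F : finFieldType) (V : vectType F) (T : finType)
    (L : {set T}) (psi : T -> V) :
  \dim (vspan psi L) <= 2 ->
  {in L &, forall x y, x != y -> \dim (vspan psi [set x; y]) = 2} -> #|L| <= #|F| + 1.
Proof.
move=> dL pair; have [/card_gt1P[x0 [x1 [x0L x1L x01]]]|] := boolP (1 < #|L|); last by lia.
have [v0 v10] : psi x0 != 0%R /\ psi x1 \notin <[psi x0]>%VS.
  by apply: dim_vline_pair; rewrite -vspan2 pair.
have eL : vspan psi [set x0; x1] = vspan psi L.
  by apply/eqP; rewrite eqEdim pair // dL vspanS // subUset !sub1set x0L.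
have slope x : x \in L :\ x0 -> exists k : F, psi x \in <[(k *: psi x0 + psi x1)%R]>%VS.
  case/setD1P=> xx0 xL; have := mem_vspan psi xL; rewrite -eL vspan2.
  case/memv_addP=> _ /vlineP[a ->] [_ /vlineP[b ->] e].
  have [b0|b0] := eqVneq b 0%R.
    have := pair _ _ xL x0L xx0.
    rewrite vspan2 (addv_idPr _) -?memvE ?dim_vline; first by lia.
    by rewrite e b0 scale0r addr0 memvZ ?memv_line.
  exists (a / b)%R; apply/vlineP; exists b.
  by rewrite scalerDr scalerA mulrC divfK.
have /fin_all_exists[k kP] : forall x, exists k : F, x \in L :\ x0 ->
    psi x \in <[(k *: psi x0 + psi x1)%R]>%VS.
  by move=> x; have [/slope[k]|] := boolP (x \in L :\ x0); [exists k | exists 0%R].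
have inj : {in L :\ x0 &, injective k}.
  move=> x y xL yL exy; apply/eqP; apply: contraT => xy.
  have [_ xL'] := setD1P xL; have [_ yL'] := setD1P yL.
  have := pair x y xL' yL' xy.
  have : (vspan psi [set x; y] <= <[(k x *: psi x0 + psi x1)%R]>)%VS.
    by rewrite vspan2 subv_add -!memvE {2}exy !kP.
  by move/dimvS => /[swap] ->; rewrite dim_vline; lia.
have : #|L :\ x0| <= #|F|.
  by rewrite -(card_in_imset inj) max_card.
by rewrite (cardsD1 x0 L) x0L; lia.
Qed.

(** Induction on the rank of [M]. If [A] spans, some point of [L] is parallel to no point of [A],
    since a line over [F] has at most q+1 points. Otherwise roundness yields an element outside both
    closures to contract. *)
Lemma line_minor_round (F : finFieldType) (V : vectType F) (T : finType)
    (M : matroid T) (A L : {set T}) (phi : T -> V) :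
  round_cover M -> pg_rep M A phi -> 3 <= \dim {:V} -> line M (#|F| + 2) L ->
  line_minor M (#|F| ^ 2 + 1).
Proof.
move=> + rep dV; move en : (rk M [set: T]) => n.
elim/ltn_ind: n M en rep => n IH M en rep rM [cL rL pL]; have rA := rk_pg_rep rep.
have [sp|nsp] := eqVneq (rk M A) (rk M [set: T]).
  have spz z : rk M (A :|: [set z]) = rk M A.
    apply/eqP; rewrite eqn_leq sp rk_mono ?subsetT //= -sp rk_mono //.
    exact: subsetUl.
  have [/existsP[z /andP[zL /forall_inP zP]]|no] := boolP [exists z, (z \in L) &&
      [forall x in A, (rk M [set x] == 1) ==> (rk M [set x; z] == 2)]].
    apply: line_minor_spanned rep dV _ (spz z) => x xA rx.
    by have := zP x xA; rewrite rx eqxx => /eqP.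
  have par z : z \in L -> exists2 x, x \in A & rk M [set x] = 1 /\ rk M [set x; z] = 1.
    move=> zL; move: no; rewrite negb_exists => /forallP/(_ z).
    rewrite zL => /forall_inPn[x xA]; rewrite negb_imply => /andP[/eqP rx ne].
    exists x => //; split=> //; have := rk_mono M (subsetUl [set x] [set z]).
    have := rkU_le M [set x] [set z]; have := rk1_le M z; rewrite rx; lia.
  (* [p] picks for each point of [L] a parallel point of [A]; off [L] its value is arbitrary. *)
  have /fin_all_exists[p pP] : forall z, exists x, z \in L ->
      [/\ x \in A, rk M [set x] = 1 & rk M [set x; z] = 1].
    move=> z; have [/par[x xA [rx rxz]]|] := boolP (z \in L); last by exists z.
    by exists x.
  have clp (X : {set T}) : X \subset L -> rk M (p @: X) = rk M X.
    move=> sXL; transitivity (rk M (p @: X :|: X)).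
      symmetry; apply: rkU_closure => z zX.
      have [pA rpz rpzz] := pP z (subsetP sXL z zX).
      by apply: (rkU_id (X := [set p z])); rewrite ?sub1set ?imset_f // rpzz rpz.
    rewrite setUC; apply: rkU_closure => _ /imsetP[z zX ->].
    have [pA rpz rpzz] := pP z (subsetP sXL z zX).
    apply: (rkU_id (X := [set z])); rewrite ?sub1set // setUC rpzz.
    have [y yL yz] : exists2 y, y \in L & y != z.
      have : 0 < #|L :\ z|.
        have : 0 < #|F| by apply/card_gt0P; exists 0%R.
        by move: cL; rewrite (cardsD1 z L); lia.
      by case/card_gt0P=> y /setD1P[yz yL]; exists y.
    have := pL _ _ yL (subsetP sXL z zX) yz; have := rkU_le M [set y] [set z].
    by have := rk1_le M z; have := rk1_le M y; lia.
  have sub (X : {set T}) : X \subset L -> \dim (vspan (phi \o p) X) = rk M X.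
    move=> sXL; rewrite -clp // rep.1.
      congr (\dim _); apply/eqP; rewrite eqEsubv; apply/andP; split.
        by apply/vspan_subP => x xX; exact: (mem_vspan phi (imset_f p xX)).
      by apply/vspan_subP => _ /imsetP[x xX ->]; apply: (mem_vspan (phi \o p)).
    by apply/subsetP => _ /imsetP[x xX ->]; have [] := pP x (subsetP sXL x xX).
  have : #|L| <= #|F| + 1.
    apply: (@card_pairwise_indep F V T L (phi \o p)); rewrite ?sub ?rL //.
    by move=> x y xL yL xy; rewrite sub ?pL // subUset !sub1set xL.
  by rewrite cL; lia.
have [z zA zL] : exists2 z, rk M (A :|: [set z]) != rk M A & rk M (L :|: [set z]) != rk M L.
  have [/existsP[z /andP[zA zL]]|no] := boolP [exists z,
    (rk M (A :|: [set z]) != rk M A) && (rk M (L :|: [set z]) != rk M L)];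
    first by exists z.
  (* Without such a [z] the two closures cover everything and one of them is spanning; but [A] does
     not span, and [L] has rank 2, less than the rank of [A]. *)
  pose cA := [set z | rk M (A :|: [set z]) == rk M A].
  pose cL' := [set z | rk M (L :|: [set z]) == rk M L].
  have : cA :|: cL' = [set: T].
    apply/setP => z; rewrite !inE; move: no; rewrite negb_exists => /forallP/(_ z).
    by rewrite negb_and !negbK.
  have clA : rk M (A :|: cA) = rk M A.
    by apply: rkU_closure => z; rewrite inE => /eqP.
  have clL : rk M (L :|: cL') = rk M L.
    by apply: rkU_closure => z; rewrite inE => /eqP.
  have := rk_mono M (subsetT A); have := rk_mono M (subsetT L).
  have := rk_mono M (subsetUr A cA); have := rk_mono M (subsetUr L cL').
  by move=> h1 h2 h3 h4 /rM[] h5; lia.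
have zA1 (X : {set T}) : X \subset A -> rk M (X :|: [set z]) = rk M X + 1.
  move=> /(rk_submod_le M [set z]); have := rkU_le M X [set z]; have := rk1_le M z.
  by have := rk_mono M (subsetUl A [set z]); lia.
have zL1 : rk M (L :|: [set z]) = rk M L + #|[set z]|.
  have := rkU_le M L [set z]; have := rk1_le M z; rewrite cards1.
  by have := rk_mono M (subsetUl L [set z]); lia.
have rz : rk M [set z] = 1 by have := zA1 _ (sub0set A); rewrite set0U rk0.
apply: (@line_minor_contract _ _ _ [set z]).
apply: (IH (rk (contract M [set z]) [set: T])) => //.
- have := rk_contract M [set z] [set: T]; rewrite (setUidPl (subsetT _)) rz.
  by have := rk_mono M (subsetT [set z]); lia.
- split=> [X sXA|]; last exact: rep.2.
  by have := rk_contract M [set z] X; rewrite zA1 // rz rep.1 //; lia.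
- exact: round_cover_contract.
- exact: line_contract.
Qed.

(** * Undoing the contraction of a point *)

(** Each point of the geometry of [M / e] is a class containing [c] elements pairwise nonparallel in
    [M]. If [e] is not a loop, these lie on a line of [M] through [e]. *)
Definition rich (F : finFieldType) (V : vectType F) (T : finType) (M : matroid T)
    (e : T) (A : {set T}) (phi : T -> V) (c : nat) : Prop :=
  pg_rep (contract M [set e]) A phi /\
  (forall v : V, v != 0%R -> exists Y : {set T},
    [/\ Y \subset A, #|Y| = c, {in Y, forall y, <[phi y]>%VS = <[v]>%VS} &
        {in Y &, forall y y', y != y' -> rk M [set y; y'] = 2}]).

Lemma rich_ext (F : finFieldType) (V : vectType F) (T : finType) (M N : matroid T)
    (e : T) (A : {set T}) (phi : T -> V) (c : nat) :
  rk M =1 rk N -> rich M e A phi c -> rich N e A phi c.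
Proof.
move=> eMN [rep cls]; split.
  by apply: pg_rep_ext rep => X /=; rewrite /contract_rk !eMN.
move=> v /cls[Y [sYA cY lY pY]]; exists Y; split=> // y y' yY y'Y yy'.
by rewrite -eMN pY.
Qed.

Lemma rich_sub (F : finFieldType) (V W : vectType F) (f : 'Hom(W, V)) (T : finType)
    (M : matroid T) (e : T) (A : {set T}) (phi : T -> V) (c : nat) :
  rich M e A phi c -> lker f = 0%VS ->
  rich M e (flat A phi (limg f)) (f^-1%VF \o phi) c.
Proof.
move=> [rep cls] kf; split; first exact: pg_rep_sub.
move=> w w0; have fw0 : f w != 0%R by rewrite -memv_ker kf memv0.
have [Y [/subsetP sYA cY lY pY]] := cls _ fw0; exists Y; split=> //.
  by apply/subsetP => y yY; rewrite inE sYA // memvE lY // -memvE memv_img ?memvf.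
by move=> y yY; rewrite /= -limg_line lY // limg_line lker0_lfunK // kf.
Qed.

(* Contracting [a] produces a class with more than [c] points out of the classes
   on the line through [phi a] and [phi b]. *)
Definition gain (F : finFieldType) (V : vectType F) (T : finType) (M : matroid T)
    (A : {set T}) (phi : T -> V) (c : nat) (a b : T) (Y : {set T}) : bool :=
  [&& a \in A, phi a != 0%R, phi b \notin <[phi a]>%VS, Y \subset A, #|Y| == c.+1,
      [forall y in Y, (phi y \in <[phi a]> + <[phi b]>)%VS && (phi y \notin <[phi a]>%VS)] &
      [forall y in Y, forall y' in Y, (y != y') ==> (rk M [set a; y; y'] == 3)]].

Lemma rk_over_point (F : finFieldType) (V : vectType F) (T : finType) (M : matroid T)
    (e : T) (A X : {set T}) (phi : T -> V) :
  rk M [set e] = 1 -> pg_rep (contract M [set e]) A phi -> X \subset A ->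
  rk M (X :|: [set e]) = (\dim (vspan phi X)).+1.
Proof. by move=> re rep sXA; rewrite -rk_contract re rep.1 // addn1. Qed.

(** If no element of the class [Z] of [v + w] is spanned by [x] and [y] in [M], then contracting [x]
    merges [y] and [Z] into one class of [c + 1] elements, an excluded gain. *)
Lemma rich_closure_lines (F : finFieldType) (V : vectType F) (T : finType)
    (M : matroid T) (e : T) (A : {set T}) (phi : T -> V) (c : nat) (x y : T) (v w : V) :
  rk M [set e] = 1 -> rich M e A phi c -> (forall a b Y, ~~ gain M A phi c a b Y) ->
  x \in A -> y \in A -> rk M [set x; y] = 2 -> v != 0%R -> w \notin <[v]>%VS ->
  <[phi x]>%VS = <[v]>%VS -> <[phi y]>%VS = <[w]>%VS ->
  exists z, [/\ z \in A, <[phi z]>%VS = <[(v + w)%R]>%VS & rk M [set x; y; z] = 2].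
Proof.
move=> re [rep cls] nogain xA yA rxy v0 wv ex ey.
have w0 : w != 0%R by apply: contraNneq wv => ->; rewrite mem0v.
have vw : v \notin <[w]>%VS.
  by apply: contra wv => /(vline_eq v0) ->; exact: memv_line.
have sv : (v + w)%R \notin <[v]>%VS.
  by apply: contra wv => h; rewrite -[w](addKr v) addrC memvB ?memv_line.
have sw : (v + w)%R \notin <[w]>%VS.
  by apply: contra vw => h; rewrite -[v](addrK w) memvB ?memv_line.
have s0 : (v + w)%R != 0%R by apply: contraNneq sv => ->; rewrite mem0v.
have [Z [sZA cZ lZ pZ]] := cls _ s0.
have yZ : y \notin Z.
  by apply: contra sw => /lZ; rewrite ey => ->; exact: memv_line.
have [/existsP[z /andP[zZ /eqP rz]]|no] :=
  boolP [exists z, (z \in Z) && (rk M [set x; y; z] == 2)].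
  by exists z; rewrite (subsetP sZA) // lZ.
have rxyz z : z \in Z -> rk M [set x; y; z] = 3.
  move=> zZ; move: no; rewrite negb_exists => /forallP/(_ z); rewrite zZ /=.
  have := rk_mono M (subsetUl [set x; y] [set z]); have := rkU_le M [set x; y] [set z].
  by rewrite rxy; have := rk1_le M z; lia.
have rxzz z z' : z \in Z -> z' \in Z -> z != z' -> rk M [set x; z; z'] = 3.
  move=> zZ z'Z zz'; have szz : [set z; z'] \subset A.
    by rewrite subUset !sub1set !(subsetP sZA).
  (* Two elements of [Z] span [e], so the rank of a set containing them can be read off in
     [M / e]. *)
  have cl : rk M ([set z; z'] :|: [set e]) = rk M [set z; z'].
    by rewrite (rk_over_point re rep) // vspan2 !lZ // addvv dim_vline s0 pZ.
  have sub : [set z; z'] \subset [set x; z; z'] by setsub.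
  rewrite -(rkU_id sub cl) (rk_over_point re rep) ?subUset ?sub1set ?xA ?(subsetP sZA) //.
  rewrite !vspanU !vspan1 ex (lZ z) // (lZ z') // -addvA addvv addvC.
  by rewrite dim_vline_add // dim_vline v0.
case/negP: (nogain x y (y |: Z)); apply/and5P; split=> //.
- by have := congr1 (fun U => \dim U) ex; rewrite !dim_vline v0; case: (_ != _).
- by apply: contra wv; rewrite memvE ey ex -memvE.
- by rewrite subUset sub1set yA.
apply/and3P; split; first by rewrite cardsU1 yZ cZ.
  apply/forall_inP => t; rewrite ex ey in_setU1 => /orP[/eqP->|tZ].
    by rewrite !memvE ey addvSr -memvE.
  rewrite memvE lZ // -memvE memv_add ?memv_line //=.
  by apply: contra sv; rewrite memvE lZ.
apply/forall_inP => t; rewrite in_setU1 => tY; apply/forall_inP => t'.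
rewrite in_setU1 => t'Y; apply/implyP => tt'; apply/eqP.
case/orP: tY => [/eqP et|tZ]; case/orP: t'Y => [/eqP et'|t'Z].
- by rewrite et et' eqxx in tt'.
- by rewrite et rxyz.
- by rewrite et' setUAC rxyz.
- exact: rxzz.
Qed.

(** Lift a basis to a set [B]. Its closure in [M] avoids [e], so ranks in [M] and [M / e] agree on
    the part [A'] of [A] in this closure. By [rich_closure_lines] the directions found in [A'] are
    closed under sums, so [A'] meets every class. *)
Lemma rich_linear (F : finFieldType) (V : vectType F) (T : finType)
    (M : matroid T) (e : T) (A : {set T}) (phi : T -> V) (c : nat) :
  rk M [set e] = 1 -> rich M e A phi c -> (forall a b Y, ~~ gain M A phi c a b Y) ->
  exists2 A' : {set T}, pg_rep M A' phi & pg_rep (contract M [set e]) A' phi.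
Proof.
move=> re richA nogain; have rep := richA.1; set n := \dim {:V}.
pose b := vbasis {:V}.
have bn0 (i : 'I_n) : (b`_i)%R != 0%R.
  by apply: (basis_not0 (vbasisP {:V})); apply: mem_nth; rewrite size_tuple.
have [a aA ea] := fin_all_exists2 (fun i => rep.2 _ (bn0 i)).
pose B := a @: [set: 'I_n].
have sBA : B \subset A by apply/subsetP => _ /imsetP[i _ ->].
have spB : vspan phi B = fullv.
  apply/eqP; rewrite eqEsubv subvf -(span_basis (vbasisP fullv)).
  apply/span_subvP => _ /(nthP 0%R)[i + <-]; rewrite size_tuple => lin.
  rewrite memvE -[i]/(nat_of_ord (Ordinal lin)) -ea -memvE.
  by apply: mem_vspan; apply: imset_f.
have rBe : rk M (B :|: [set e]) = n.+1 by rewrite (rk_over_point re rep) // spB.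
have rB : rk M B = n.
  have := rk_card M B; have := leq_imset_card a [set: 'I_n]; rewrite cardsT card_ord.
  by have := rkU_le M B [set e]; rewrite rBe re -/B; lia.
pose A' := [set x in A | rk M (B :|: [set x]) == rk M B].
have sA' : A' \subset A by apply/subsetP => x; rewrite inE => /andP[].
have clA' x : x \in A' -> rk M (B :|: [set x]) = rk M B.
  by rewrite inE => /andP[_ /eqP].
have rBA' : rk M (B :|: A') = n by rewrite rkU_closure.
(* [e] raises the rank of the closure of [B], hence that of each subset. *)
have skew (X : {set T}) : X \subset A' -> rk M (X :|: [set e]) = (rk M X).+1.
  move=> sX; have := rk_submod_le M [set e] (subset_trans sX (subsetUr B A')).
  have := rk_mono M (setSU [set e] (subsetUl B A')); rewrite rBe rBA'.
  by have := rkU_le M X [set e]; rewrite re; lia.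
have rA' (X : {set T}) : X \subset A' -> rk M X = \dim (vspan phi X).
  move=> sX; have := skew X sX; rewrite (rk_over_point re rep) ?(subset_trans sX) //.
  by case.
pose K (v : V) := v != 0%R -> exists2 x, x \in A' & <[phi x]>%VS = <[v]>%VS.
have KZ k v : K v -> K (k *: v)%R.
  move=> Kv kv0; have : v != 0%R by apply: contraNneq kv0 => ->; rewrite scaler0.
  case/Kv=> x xA' ex; exists x => //; rewrite ex; apply/esym/vline_eq => //.
  by rewrite memvZ ?memv_line.
have KD v w : K v -> K w -> K (v + w)%R.
  move=> Kv Kw s0; have [v0|v0] := eqVneq v 0%R.
    by move: s0; rewrite v0 add0r => /Kw.
  have [x xA' ex] := Kv v0; have [wv|wv] := boolP (w \in <[v]>%VS).
    exists x => //; rewrite ex; apply/esym/vline_eq => //.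
    by rewrite memvD ?memv_line.
  have w0 : w != 0%R by apply: contraNneq wv => ->; rewrite mem0v.
  have [y yA' ey] := Kw w0.
  have sxy : [set x; y] \subset A' by rewrite subUset !sub1set xA'.
  have rxy : rk M [set x; y] = 2.
    by rewrite rA' // vspan2 ex ey addvC dim_vline_add // dim_vline v0.
  have [z [zA ez rz]] := rich_closure_lines re richA nogain (subsetP sA' _ xA')
    (subsetP sA' _ yA') rxy v0 wv ex ey.
  exists z => //; rewrite inE zA /=; apply/eqP.
  have rBxy : rk M (B :|: [set x; y]) = rk M B.
    by apply: rkU_closure => t /(subsetP sxy); apply: clA'.
  have := rkU_id (subsetUr B [set x; y]) (etrans rz (esym rxy)); rewrite rBxy.
  have := rk_mono M (subsetUl B [set z]).
  have : rk M (B :|: [set z]) <= rk M (B :|: [set x; y] :|: [set z]).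
    by apply: rk_mono; setsub.
  lia.
have Kall v : K v.
  rewrite (coord_vbasis (memvf v)); elim/big_ind: _ => [|//|i _]; first by rewrite /K eqxx.
  apply: KZ => _; exists (a i); last by rewrite ea.
  by rewrite inE aA (setUidPl _) ?eqxx // sub1set imset_f.
by exists A'; split=> // X sX; rewrite rep.1 ?(subset_trans sX).
Qed.

(** * Direct sums and the enlargement of classes *)

Lemma lfun_of_linear (F : finFieldType) (V W : vectType F) (f : V -> W) :
  linear f -> exists h : 'Hom(V, W), h =1 f.
Proof.
move=> lin_f; pose fL : {linear V -> W} := HB.pack f (GRing.isLinear.Build F V W _ f lin_f).
exists (linfun fL); exact: (lfunE fL).
Qed.

(** The space of functions from [J] to [W], written in coordinates of a basis because the geometries
    below are indexed by row spaces. *)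
Lemma direct_sum_maps (F : finFieldType) (J : finType) (W : vectType F) :
  exists n (inj : J -> 'Hom(W, 'rV[F]_n)) (pr : J -> 'Hom('rV[F]_n, W)),
    forall p q w, pr p (inj q w) = (if p == q then w else 0)%R.
Proof.
pose V : vectType F := {ffun J -> W}; pose E := vbasis {:V}.
pose g q (w : W) : 'rV[F]_(\dim {:V}) :=
  passmx.rVof E ([ffun p => if p == q then w else 0%R] : V).
pose ev p (f : 'rV[F]_(\dim {:V})) : W := (passmx.vecof E f : V) p.
have lin_g q : linear (g q).
  move=> k u v; apply: etrans (passmx.rVof_linear E k _ _); congr (passmx.rVof E _).
  by apply/ffunP => p; rewrite !ffunE; case: eqP; rewrite ?scaler0 ?addr0.
have lin_ev p : linear (ev p).
  by move=> k u v; rewrite /ev (passmx.vecof_linear E k u v) !ffunE.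
have [inj injE] := fin_all_exists (fun q => lfun_of_linear (lin_g q)).
have [pr prE] := fin_all_exists (fun p => lfun_of_linear (lin_ev p)).
exists (\dim {:V}), inj, pr => p q w.
by rewrite prE injE /ev /g passmx.rVofK ?vbasisP // ffunE.
Qed.

Lemma functional_pair (F : finFieldType) (W U : vectType F) (u v : W) (p : U) :
  u != 0%R -> v \notin <[u]>%VS -> exists2 h : 'Hom(W, U), h u = 0%R & h v = p.
Proof.
move=> u0 vu; have [h hP] := linear_of_free [:: v; u] [:: p; 0%R].
have : free [:: v; u] by rewrite free_cons span_seq1 vu seq1_free.
by move/hP => /(_ erefl)[hv hu]; exists (linfun h); rewrite (lfunE h).
Qed.

(** There is one summand [W] for each vector [p] of the target. Its gain has a point [a p] to
    contract and a second point [b p]; the quotient map [K] sends the first to 0 and the second to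
    [p], so the [c + 1] elements of [Y p] fall into the class of [p]. *)
Lemma rich_spread (F : finFieldType) (V W : vectType F) (k : nat)
    (inj : 'rV[F]_k -> 'Hom(W, V)) (pr : 'rV[F]_k -> 'Hom(V, W)) (T : finType)
    (M : matroid T) (e : T) (A : {set T}) (phi : T -> V) (c : nat) :
  (forall p q w, pr p (inj q w) = (if p == q then w else 0)%R) ->
  rk M [set e] = 1 -> rich M e A phi c ->
  (forall p, exists a b Y,
     gain M (flat A phi (limg (inj p))) ((inj p)^-1%VF \o phi) c a b Y) ->
  exists (I : {set T}) (psi : T -> 'rV[F]_k),
    [/\ I \subset A, rk (contract M [set e]) I = #|I| & rich (contract M I) e A psi c.+1].
Proof.
move=> prinj re [rep _] gains; set N := contract M [set e] in rep *.
have [a] := fin_all_exists gains; case/fin_all_exists=> b /fin_all_exists[Y gainP].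
pose al p := (inj p)^-1%VF (phi (a p)); pose be p := (inj p)^-1%VF (phi (b p)).
have gA p : a p \in flat A phi (limg (inj p)) by case/and5P: (gainP p).
have al0 p : al p != 0%R by case/and5P: (gainP p).
have bal p : be p \notin <[al p]>%VS by case/and5P: (gainP p).
have aA p : a p \in A by have := gA p; rewrite inE => /andP[].
have ea p : phi (a p) = inj p (al p).
  by have := gA p; rewrite inE => /andP[_ /limg_lfunVK].
have [h h_al h_be] := fin_all_exists2
  (fun p : 'rV[F]_k => functional_pair (p : 'rV[F]_k) (al0 p) (bal p)).
pose K : 'Hom(V, 'rV[F]_k) := (\sum_p (h p \o pr p)%VF)%R.
have Kinj p w : K (inj p w) = h p w.
  rewrite sum_lfunE (bigD1 p) //= comp_lfunE prinj eqxx big1 ?addr0 // => q qp.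
  by rewrite comp_lfunE prinj (negPf qp) linear0.
pose J := a @: [set: 'rV[F]_k].
have sJ : J \subset flat A phi (lker K).
  by apply/subsetP => _ /imsetP[p _ ->]; rewrite inE aA memv_ker ea Kinj h_al /=.
(* The vectors [phi (a p)] are nonzero and lie in different summands, hence are independent. *)
have indJ : rk N J = #|J|.
  apply/eqP; rewrite eqn_leq rk_card rep.1 ?(subset_trans sJ) ?flat_sub //=.
  apply: (@leq_trans #|{: 'rV[F]_k}|); first by rewrite -cardsT leq_imset_card.
  have dir : directv (\sum_p <[phi (a p)]>)%VS.
    apply/directv_sum_independent => us usP us0 p _.
    have [t et] := vlineP _ _ (usP p isT).
    have : pr p (\sum_i us i)%R = 0%R by rewrite us0 linear0.
    rewrite linear_sum (bigD1 p) //= big1 => [|q qp].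
      rewrite addr0 et linearZ /= ea prinj eqxx => /eqP.
      by rewrite scaler_eq0 (negPf (al0 p)) orbF => /eqP->; rewrite scale0r.
    have [t' ->] := vlineP _ _ (usP q isT).
    by rewrite linearZ /= ea prinj eq_sym (negPf qp) scaler0.
  have -> : #|{: 'rV[F]_k}| = \dim (\sum_p <[phi (a p)]>)%VS.
    rewrite (directvP dir) /= -sum1_card; apply: eq_bigr => p _.
    rewrite dim_vline ea; case: eqP => // /(congr1 (pr p)).
    by rewrite prinj eqxx linear0 => /eqP; rewrite (negPf (al0 p)).
  apply/dimvS/subv_sumP => p _; rewrite -memvE; apply: mem_vspan; exact: imset_f.
(* [I] completes the points [a p] to a basis of the kernel of [K]. *)
have [I [sJI sI rI rIS]] := extend_indep sJ indJ.
have sIA := subset_trans sI (flat_sub _ _ _).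
have spI : vspan phi I = lker K.
  apply/eqP; rewrite eqEdim -rep.1 // rIS (rk_flat _ rep) leqnn andbT.
  by rewrite -(vspan_flat (lker K) rep) vspanS.
have imK : limg K = fullv.
  apply/vspaceP => p; rewrite memvf -(h_be p) -Kinj memv_img ?memvf //.
have repK := pg_rep_contract rep sIA spI imK.
exists I, (K \o phi); split=> //; split.
  by apply: pg_rep_ext repK => X; rewrite rk_contractC.
move=> p p0; exists (Y p).
have /and5P[_ _ _ sY /and3P[/eqP cY /forall_inP lY /forall_inP pY]] := gainP p.
have sYA : Y p \subset A := subset_trans sY (flat_sub _ _ _).
have ey y : y \in Y p -> phi y = inj p ((inj p)^-1%VF (phi y)).
  by move/(subsetP sY); rewrite inE => /andP[_ /limg_lfunVK].
have lYK y : y \in Y p -> <[(K \o phi) y]>%VS = <[p]>%VS.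
  move=> yY; have /andP[/memv_addP[_ /vlineP[s ->] [_ /vlineP[t ->] est]] ny] := lY y yY.
  have t0 : t != 0%R.
    by apply: contraNneq ny => t0; rewrite est t0 scale0r addr0 memvZ ?memv_line.
  have eK : K (phi y) = (t *: p)%R.
    have est' : (inj p)^-1%VF (phi y) = (s *: al p + t *: be p)%R := est.
    rewrite ey // Kinj est' linearD !linearZ /=.
    by rewrite h_al scaler0 add0r h_be.
  rewrite /= eK; apply: vline_eq; first by rewrite scaler_eq0 negb_or t0.
  by rewrite memvZ ?memv_line.
have rMI : rk M I = #|I|.
  have := rk_card M I; have := rk_contract M [set e] I; have := rkU_le M I [set e].
  by rewrite -/N rI re; lia.
split=> // y y' yY y'Y yy'.
have r3 : rk M [set a p; y; y'] = 3.
  by have /forall_inP/(_ _ y'Y)/implyP/(_ yy')/eqP := pY y yY.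
have sA3 : [set a p; y; y'] \subset A.
  by rewrite !subUset !sub1set aA !(subsetP sYA).
(* In [M / e] the three elements have rank at most 2, in [M] they have rank 3, so they span [e].
   Hence [e] is in the closure of [y], [y'] and [I], and undoing its contraction raises the rank of
   the pair from 1 to 2. *)
have cl : rk M ([set a p; y; y'] :|: [set e]) = rk M [set a p; y; y'].
  apply/eqP; rewrite eqn_leq [X in _ && X]rk_mono ?subsetUl // andbT r3.
  rewrite (rk_over_point re rep) // ltnS.
  apply: (@leq_trans (\dim (inj p @: (<[al p]> + <[be p]>))%VS)).
    apply/dimvS/vspan_subP => t; rewrite !inE -orbA.
    case/or3P=> /eqP->; first by rewrite ea memv_img // (subvP (addvSl _ _)) ?memv_line.
      by rewrite ey // memv_img //; case/andP: (lY y yY).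
    by rewrite ey // memv_img //; case/andP: (lY y' y'Y).
  have := limg_ker_dim (inj p) (<[al p]> + <[be p]>).
  have [+ _] := dimv_add_leqif <[al p]> <[be p]>; rewrite !dim_vline.
  by case: (_ != _); case: (_ != _); lia.
have sub : [set a p; y; y'] \subset [set y; y'] :|: I.
  rewrite !subUset !sub1set !inE !eqxx ?orbT ?andbT /= (subsetP sJI) ?orbT //.
  exact: imset_f.
have r1 : rk (contract N I) [set y; y'] = 1.
  rewrite repK.1 ?subUset ?sub1set ?(subsetP sYA) // vspan2 !lYK // addvv dim_vline p0 //.
have := rkU_id sub cl; have := rk_contract M I [set y; y'].
have := rk_contract N I [set y; y']; have := rk_contract M [set e] ([set y; y'] :|: I).
by rewrite -/N r1 rI re rMI; lia.
Qed.

(** After contracting [I], the geometry on [A'] has the same ranks with and without contracting [e].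
    Independence of [I] over [e] later keeps [L] a line. *)
Definition skew_pg (F : finFieldType) (W : vectType F) (T : finType) (M : matroid T)
    (e : T) (A : {set T}) : Prop :=
  exists (I A' : {set T}) (psi : T -> W),
    [/\ I \subset A, rk (contract M [set e]) I = #|I|, pg_rep (contract M I) A' psi &
        pg_rep (contract (contract M [set e]) I) A' psi].

Lemma indepU_contract (T : finType) (M : matroid T) (I J : {set T}) :
  rk M I = #|I| -> rk (contract M I) J = #|J| -> rk M (I :|: J) = #|I :|: J|.
Proof.
move=> rI rJ; apply/eqP; rewrite eqn_leq rk_card setUC -rk_contract rI rJ.
by rewrite cardsU leq_subr.
Qed.

(** Induction on [c], starting from empty classes. To reach [c + 1], ask for [c] on a sum of copies
    of [W], one for each vector of the [k]-dimensional row space. If every copy has a gain,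
    [rich_spread] combines them; a copy without gain yields a skew geometry by [rich_linear]. *)
Lemma rich_or_skew (F : finFieldType) (W : vectType F) (c k : nat) :
  exists n, forall (T : finType) (M : matroid T) (e : T) (A : {set T})
      (phi : T -> 'rV[F]_n),
    rk M [set e] = 1 -> pg_rep (contract M [set e]) A phi ->
    skew_pg W M e A \/
    exists (I : {set T}) (psi : T -> 'rV[F]_k),
      [/\ I \subset A, rk (contract M [set e]) I = #|I| & rich (contract M I) e A psi c].
Proof.
elim: c k => [|c IH] k.
  exists k => T M e A phi re rep; right; exists set0, phi.
  split; rewrite ?sub0set ?rk0 ?cards0 //; split.
    apply: pg_rep_ext rep => X; rewrite rk_contract2.
    by rewrite /= /contract_rk set0U.
  by move=> v v0; exists set0; split; rewrite ?sub0set ?cards0 // => y; rewrite inE.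
have [n1 [inj [pr prinj]]] := direct_sum_maps 'rV[F]_k W.
have [n nP] := IH n1; exists n => T M e A phi re rep.
have [|[I [psi [sIA rI richI]]]] := nP T M e A phi re rep; first by left.
have reI : rk (contract M I) [set e] = 1.
  have := rk_contract M I [set e]; have := rk_contract M [set e] I.
  have := rk_card M I; have := rkU_le M I [set e]; rewrite setUC re rI; lia.
pose g p := [exists a, exists b, exists Y,
  gain (contract M I) (flat A psi (limg (inj p))) ((inj p)^-1%VF \o psi) c a b Y].
have [/forallP gains|/forallPn[p nop]] := boolP [forall p, g p].
  right; have [|J [psi' [sJA rJ richJ]]] := rich_spread prinj reI richI.
    by move=> p; have /existsP[a /existsP[b /existsP[Y]]] := gains p; exists a, b, Y.
  exists (I :|: J), psi'; split; first by rewrite subUset sIA.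
    by apply: indepU_contract => //; rewrite rk_contractC.
  by apply: rich_ext richJ => X; rewrite rk_contract2.
left; have kinj : lker (inj p) = 0%VS.
  apply/eqP/lker0P => u v /(congr1 (pr p)); by rewrite !prinj eqxx.
have [|A' repM repE] := rich_linear reI (rich_sub richI kinj).
  move=> a b Y; apply: contra nop => h; apply/existsP; exists a.
  by apply/existsP; exists b; apply/existsP; exists Y.
exists I, A', ((inj p)^-1%VF \o psi); split=> //.
by apply: pg_rep_ext repE => X; rewrite rk_contractC.
Qed.

(** One class of q^2 elements is enough, hence dimension 1; together with [e] it is a line with q^2
    + 1 points. *)
Lemma line_minor_or_skew (F : finFieldType) (W : vectType F) :
  exists n, forall (T : finType) (M : matroid T) (e : T) (A : {set T})
      (phi : T -> 'rV[F]_n),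
    rk M [set e] = 1 -> pg_rep (contract M [set e]) A phi ->
    line_minor M (#|F| ^ 2 + 1) \/ skew_pg W M e A.
Proof.
have [n nP] := rich_or_skew W (#|F| ^ 2) 1; exists n => T M e A phi re rep.
have [|[I [psi [sIA rI [repI cls]]]]] := nP T M e A phi re rep; first by right.
left; have [u v0] : exists u : 'rV[F]_1, u != 0%R.
  by exists (const_mx 1%R); apply/eqP => /rowP/(_ 0%R)/eqP; rewrite !mxE oner_eq0.
have [Y [sYA cY lY pY]] := cls _ v0.
have reI : rk (contract M I) [set e] = 1.
  have := rk_contract M I [set e]; have := rk_contract M [set e] I.
  have := rk_card M I; have := rkU_le M I [set e]; rewrite setUC re rI; lia.
have rYe (X : {set T}) : X \subset Y -> X != set0 -> rk (contract M I) (X :|: [set e]) = 2.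
  move=> sXY /set0Pn[x xX].
  rewrite (rk_over_point reI repI) ?(subset_trans sXY) //.
  have -> : vspan psi X = <[u]>%VS; last by rewrite dim_vline v0.
  apply/eqP; rewrite eqEsubv; apply/andP; split.
    by apply/vspan_subP => y /(subsetP sXY)/lY => <-; exact: memv_line.
  by rewrite -(lY x) ?(subsetP sXY) // -memvE mem_vspan.
have eY : e \notin Y.
  apply/negP => eY; suff : 1 = 2 by [].
  have := rYe [set e]; rewrite sub1set eY setUid reI.
  by move/(_ isT); apply; apply/set0Pn; exists e; rewrite inE.
have q0 : 0 < #|F| by apply/card_gt0P; exists 0%R.
exists I, (e |: Y); split.
- by rewrite cardsU1 eY cY addnC.
- rewrite setUC rYe // -card_gt0 cY expn_gt0 q0 //.
have re2 y : y \in Y -> rk (contract M I) [set y; e] = 2.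
  by move=> yY; apply: rYe; rewrite ?sub1set //; apply/set0Pn; exists y; rewrite inE.
move=> x y; rewrite !in_setU1 => /orP[/eqP->|xY] /orP[/eqP->|yY] xy.
- by rewrite eqxx in xy.
- by rewrite setUC re2.
- by rewrite re2.
- exact: pY.
Qed.

(** * Reduction to a geometry skew to the line *)

Lemma dim_rV (F : finFieldType) (n : nat) : \dim {:'rV[F]_n} = n.
Proof. by rewrite dimvf dim_matrix; exact: mul1n. Qed.

Lemma pg_rep_rV (F : finFieldType) (V : vectType F) (n : nat) (T : finType)
    (M : matroid T) (A : {set T}) (phi : T -> V) :
  pg_rep M A phi -> \dim {:V} = n -> exists psi : T -> 'rV[F]_n, pg_rep M A psi.
Proof.
move=> rep dV; case: n / dV; have vb := vbasisP {:V}.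
have [h hE] := lfun_of_linear (passmx.rVof_linear (vbasis {:V})).
have kh : lker h = 0%VS.
  apply/eqP/lker0P => u v; rewrite !hE => /(congr1 (passmx.vecof (vbasis {:V}))).
  by rewrite !passmx.rVofK.
have imh : limg h = fullv.
  apply/vspaceP => w; rewrite memvf -[w](passmx.vecofK vb) -hE memv_img ?memvf //.
exists (h \o phi).
have : vspan phi set0 = lker h by rewrite kh /vspan big_set0.
move/(pg_rep_contract rep (sub0set A))/(_ imh); apply: pg_rep_ext => X.
by rewrite /= /contract_rk setU0 rk0 subn0.
Qed.

(** Keep the vectors whose last [k] coordinates vanish. *)
Lemma pg_rep_le (F : finFieldType) (n k : nat) (T : finType) (M : matroid T)
    (A : {set T}) (phi : T -> 'rV[F]_(n + k)) :
  pg_rep M A phi -> exists A' (psi : T -> 'rV[F]_n), pg_rep M A' psi.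
Proof.
move=> rep; have lin : linear (fun u : 'rV[F]_n => row_mx u 0 : 'rV[F]_(n + k))%R.
  by move=> a u v; rewrite scale_row_mx add_row_mx scaler0 addr0.
have [f fE] := lfun_of_linear lin.
exists (flat A phi (limg f)), (f^-1%VF \o phi); apply: pg_rep_sub => //.
by apply/eqP/lker0P => u v; rewrite !fE => /eq_row_mx[].
Qed.

(** It suffices to find a hyperplane, the complement of some [v], skew to [z]. Any one does if [z]
    is a loop or outside the closure of [A]; if [z] is parallel to a point [x] of [A], take [v] to
    be [phi x]. In the remaining case [line_minor_spanned] applies. *)
Lemma pg_rep_avoid (F : finFieldType) (V : vectType F) (n : nat) (T : finType)
    (M : matroid T) (A : {set T}) (phi : T -> V) (z : T) :
  pg_rep M A phi -> \dim {:V} = n.+1 -> 1 < n ->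
  line_minor M (#|F| ^ 2 + 1) \/
  exists A' (psi : T -> 'rV[F]_n), pg_rep (contract M [set z]) A' psi.
Proof.
move=> rep dV n1.
suff [|[v v0 skew]] : line_minor M (#|F| ^ 2 + 1) \/
    exists2 v : V, v != 0%R & forall X : {set T}, X \subset flat A phi (<[v]>^C)%VS ->
      rk M (X :|: [set z]) = rk M X + rk M [set z]; first by left.
  right; set H := (<[v]>^C)%VS in skew *.
  have [f fE] := lfun_of_linear (@vsval_is_linear _ _ H).
  have kf : lker f = 0%VS by apply/eqP/lker0P => u w; rewrite !fE => /subvs_inj.
  have imf : limg f = H.
    apply/vspaceP => u; apply/memv_imgP/idP => [[w _ ->]|uH].
      by rewrite fE subvsP.
    by exists (vsproj H u); rewrite ?memvf // fE vsprojK.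
  have dH : \dim {:subvs_of H} = n.
    have := limg_ker_dim f fullv; rewrite capfv kf dimv0 add0n imf => <-.
    by rewrite dimv_compl dV dim_vline v0 subn1.
  have repH := pg_rep_sub rep kf; rewrite imf in repH.
  have repz : pg_rep (contract M [set z]) (flat A phi H) (f^-1%VF \o phi).
    split; last exact: repH.2.
    by move=> X sX; have := rk_contract M [set z] X; rewrite skew // -repH.1 //; lia.
  by have [psi repn] := pg_rep_rV repz dH; exists (flat A phi H), psi.
have nz : exists v : V, v != 0%R.
  by exists (vpick fullv); rewrite vpick0 -dimv_eq0 dV.
have [z0|zn0] := eqVneq (rk M [set z]) 0.
  right; have [v v0] := nz; exists v => // X _.
  by have := rkU_le M X [set z]; have := rk_mono M (subsetUl X [set z]); lia.
have rz : rk M [set z] = 1 by have := rk1_le M z; lia.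
have [zA|zA] := eqVneq (rk M (A :|: [set z])) (rk M A); last first.
  right; have [v v0] := nz; exists v => // X sX.
  have := rk_submod_le M [set z] (subset_trans sX (flat_sub _ _ _)).
  by have := rkU_le M X [set z]; have := rk_mono M (subsetUl A [set z]); lia.
have [/forall_inP spr|/forall_inPn[x xA]] := boolP [forall x in A,
    (rk M [set x] == 1) ==> (rk M [set x; z] == 2)].
  left; apply: line_minor_spanned rep _ _ zA; first by rewrite dV.
  by move=> x xA rx; have := spr x xA; rewrite rx eqxx => /eqP.
rewrite negb_imply => /andP[/eqP rx rxz].
have {}rxz : rk M [set x; z] = 1.
  have := rkU_le M [set x] [set z]; have := rk_mono M (subsetUl [set x] [set z]); lia.
have sx : [set x] \subset A by rewrite sub1set.
right; exists (phi x).
  by move: rx; rewrite rep.1 // vspan1 dim_vline; case: (_ != _).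
move=> X sX; have sXA := subset_trans sX (flat_sub _ _ _).
have xX : phi x \notin vspan phi X.
  apply/negP => h; have : phi x \in (<[phi x]> :&: <[phi x]>^C)%VS.
    rewrite memv_cap memv_line; apply: subvP h; apply/vspan_subP => y /(subsetP sX).
    by rewrite inE => /andP[].
  rewrite capv_compl memv0 => /eqP p0; move: rx.
  by rewrite rep.1 // vspan1 p0 dim_vline eqxx.
have r1 : rk M (X :|: [set x]) = rk M X + 1.
  by rewrite !rep.1 ?subUset ?sXA // vspanU vspan1 addvC dim_vline_add // addn1.
have h1 : rk M (X :|: [set x] :|: [set z]) = rk M (X :|: [set x]).
  by apply: rkU_id (subsetUr X [set x]) _; rewrite rxz rx.
have h2 : rk M (X :|: [set z] :|: [set x]) = rk M (X :|: [set z]).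
  by apply: rkU_id (subsetUr X [set z]) _; rewrite setUC rxz rz.
by rewrite rz -r1 -h1 setUAC h2.
Qed.

(** * Translation to and from the notions of the theorem *)

(** Both halves go through one induction: adding a generator changes the rank according to
    membership, on which the two sums must agree. *)
Lemma rank_vline_sum (F : finFieldType) (n : nat) (r : seq 'rV[F]_n) :
  (forall u, (u <= \sum_(v <- r) <<v>>)%MS = (u \in \sum_(v <- r) <[v]>)%VS) /\
  \rank (\sum_(v <- r) <<v>>)%MS = \dim (\sum_(v <- r) <[v]>)%VS.
Proof.
elim: r => [|v r [mem_r rk_r]].
  rewrite !big_nil mxrank0 dimv0; split=> // u.
  by rewrite submx0 memv0.
rewrite !big_cons; set S := (\sum_(v <- r) <<v>>)%MS in mem_r rk_r *.
set U := (\sum_(v <- r) <[v]>)%VS in mem_r rk_r *; split.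
  move=> u; apply/sub_addsmxP/memv_addP => [[[a b] /= ->]|[_ /vlineP[a ->] [w wU ->]]].
    exists (a *m <<v>>%MS)%R.
      have : ((a *m <<v>>%MS)%R <= v)%MS by rewrite (submx_trans (submxMl _ _)) ?genmxE.
      by case/sub_rVP=> t ->; rewrite memvZ ?memv_line.
    by exists (b *m S)%R; rewrite // -mem_r submxMl.
  have : ((a *: v)%R <= <<v>>)%MS by rewrite genmxE scalemx_sub.
  case/submxP=> B eB; move: wU; rewrite -mem_r => /submxP[D eD].
  by exists (B, D); rewrite eB eD.
have [vU|vU] := boolP (v \in U).
  have /addsmx_idPr e : (<<v>> <= S)%MS by rewrite genmxE mem_r.
  by rewrite e (addv_idPr _) -?memvE.
rewrite dim_vline_add // -rk_r mxrank_disjoint_sum.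
  rewrite mxrank_gen rank_rV; case: eqP vU => [->|//].
  by rewrite mem0v.
apply/eqP; rewrite -submx0; apply/row_subP => i.
set w := row i _.
have : (w <= <<v>> :&: S)%MS by exact: row_sub.
rewrite sub_capmx genmxE => /andP[/sub_rVP[t ->] tS].
have [->|t0] := eqVneq t 0%R; first by rewrite scale0r sub0mx.
case/negP: vU; rewrite -mem_r -[v](scalerK t0); exact: scalemx_sub.
Qed.

(** Divide by the first nonzero coordinate. *)
Lemma pg_point_normalize (F : finFieldType) (n : nat) (v : 'rV[F]_n) :
  v != 0%R -> exists2 u, pg_point u & <[u]>%VS = <[v]>%VS.
Proof.
move=> v0; have [i0 vi0] : exists i, v ord0 i != 0%R.
  apply/existsP; apply: contraNT v0; rewrite negb_exists => /forallP z.
  by apply/eqP/rowP => i; rewrite mxE; apply/eqP; have := z i; rewrite negbK.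
case: (@arg_minnP _ i0 (fun i => v ord0 i != 0%R) (fun i => i : nat) vi0) => i vi min_i.
have vi' : ((v ord0 i)^-1 != 0)%R by rewrite invr_eq0.
exists ((v ord0 i)^-1 *: v)%R.
  apply/existsP; exists i; rewrite mxE mulVf // eqxx /=; apply/forallP => j.
  apply/implyP => ji; rewrite mxE; apply/eqP.
  have [->|/min_i] := eqVneq (v ord0 j) 0%R; first by rewrite mulr0.
  by rewrite leqNgt ji.
apply: vline_eq; first by rewrite scaler_eq0 negb_or vi'.
by rewrite memvZ ?memv_line.
Qed.

Lemma pg_rep_of_minor (F : finFieldType) (n : nat) (T : finType) (M : matroid T) :
  has_minor M (PG_ground F n) (@PG_rk F n) ->
  exists (C A : {set T}) (phi : T -> 'rV[F]_n), pg_rep (contract M C) A phi.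
Proof.
case=> C [D [_ _ _ [f [_ fE fr]]]].
exists C, (minor_ground M C D), f; split=> [X sX|v].
  have := fr X sX; rewrite /minor_rk (setIidPl sX) /PG_rk => fX.
  rewrite /= /contract_rk -fX.
  have /setIidPl-> : f @: X \subset PG_ground F n by rewrite -fE imsetS.
  rewrite -big_enum (rank_vline_sum (enum (f @: X))).2 big_enum; congr (\dim _).
  apply/eqP; rewrite eqEsubv; apply/andP; split.
    by apply/subv_sumP => _ /imsetP[x xX ->]; rewrite -memvE mem_vspan.
  by apply/vspan_subP => x xX; rewrite memvE (sumv_sup (f x)) ?imset_f.
case/pg_point_normalize=> u pu <-.
have : u \in f @: minor_ground M C D by rewrite fE inE.
by case/imsetP=> x xA ->; exists x.
Qed.

Lemma line_of_restriction (m : nat) (T : finType) (M : matroid T) :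
  1 < m -> has_restriction M (U2_ground m) (@U2_rk m) -> exists L, line M m L.
Proof.
move=> m1 [L [_ [f [finj fE fr]]]]; exists L.
have cL : #|L| = m by rewrite -(card_in_imset finj) fE cardsT card_ord.
have rk2 (X : {set T}) : X \subset L -> rk M X = minn #|X| 2.
  move=> sX; have := fr X sX; rewrite (setIidPl sX) /U2_rk card_in_imset // => x y xX yX.
  by apply: finj; apply: (subsetP sX).
split=> //; first by rewrite rk2 // cL; apply/minn_idPr.
by move=> x y xL yL xy; rewrite rk2 ?cards2 ?xy // subUset !sub1set xL.
Qed.

(** Points of [L] are nonloops of the contraction, so they lie in the ground set and off [C].
    Contract the part of [C] inside the ground set and delete everything else outside [L]. *)
Lemma minor_of_line (m : nat) (T : finType) (M : matroid T) :
  1 < m -> line_minor M m -> has_minor M (U2_ground m) (@U2_rk m).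
Proof.
move=> m1 [C [L [cL rL pL]]]; case: m / cL m1 => m1.
have r1 x : x \in L -> rk (contract M C) [set x] = 1.
  move=> xL; have /card_gt0P[y /setD1P[yx yL]] : 0 < #|L :\ x|.
    by move: m1; rewrite (cardsD1 x L) xL; lia.
  have := pL _ _ yL xL yx; have := rkU_le (contract M C) [set y] [set x].
  by have := rk1_le (contract M C) x; have := rk1_le (contract M C) y; lia.
have LC x : x \in L -> (x \in ground M) && (x \notin C).
  move=> xL; have := rk_contract M C [set x]; rewrite r1 // => h.
  apply/andP; split; apply: contraT.
    move=> xE; suff : rk M ([set x] :|: C) = rk M C by lia.
    rewrite rk_ground [RHS]rk_ground; congr (rk M _).
    apply/setP => y; rewrite !inE; case: eqP => [->|//].
    by rewrite (negPf xE) !andbF.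
  by rewrite negbK => xC; move: h; rewrite (setUidPr _) ?sub1set //; lia.
have rkC (X : {set T}) : rk M (X :|: C :&: ground M) = rk M (X :|: C).
  by rewrite rk_ground [RHS]rk_ground; congr (rk M _); seteq.
pose C' := C :&: ground M; pose D := ground M :\: (C' :|: L).
have eL : minor_ground M C' D = L.
  apply/setP => x; rewrite /minor_ground !inE.
  have [/LC/andP[-> /negPf->]|_] := boolP (x \in L); first by [].
  by case: (x \in C); case: (x \in ground M).
exists C', D; split; rewrite ?subsetIr ?subsetDl //.
  by rewrite -setI_eq0; apply/eqP/setP => x; rewrite !inE; btauto.
rewrite eL; have [x0 x0L] : exists x, x \in L by apply/card_gt0P; lia.
have finj := can_in_inj (enum_rankK_in x0L).
have {}finj : {in L &, injective (enum_rank_in x0L)} by exact: finj.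
exists (enum_rank_in x0L); split=> //.
  by apply/eqP; rewrite eqEcard /U2_ground subsetT cardsT card_ord card_in_imset /=.
move=> X sX; rewrite /U2_rk card_in_imset; last first.
  by move=> x y xX yX; apply: finj; apply: (subsetP sX).
rewrite /minor_rk eL (setIidPl sX) rkC.
have -> : rk M C' = rk M C by rewrite -[C']set0U rkC set0U.
have := rk_contract M C X => h.
have -> : rk M (X :|: C) - rk M C = rk (contract M C) X by lia.
have [/card_gt1P[x [y [xX yX xy]]]|] := boolP (1 < #|X|).
  apply/eqP; rewrite eqn_leq; apply/andP; split.
    apply: leq_trans (geq_minr _ _) _; rewrite -(pL x y) ?(subsetP sX) //.
    by rewrite rk_mono // subUset !sub1set xX.
  rewrite leq_min rk_card /= -rL; exact: rk_mono.
rewrite -leqNgt leq_eqVlt ltnS leqn0 => /orP[/cards1P[x eX]|/eqP/cards0_eq->].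
  by rewrite eX cards1 r1 // -sub1set -eX.
by rewrite cards0 rk0.
Qed.

(** [e] and [f] span [L], so a set independent over both of them is skew to [L]. *)
Lemma line_contract_pair (T : finType) (M : matroid T) (m : nat) (L J : {set T}) (e f : T) :
  line M m L -> e \in L -> f \in L -> e != f ->
  rk (contract (contract M [set f]) [set e]) J = #|J| -> line (contract M J) m L.
Proof.
move=> lL eL fL ef; have [_ rL pL] := lL.
rewrite rk_contract2 => rJ; apply: line_contract lL _.
have := rk_contract M ([set f] :|: [set e]) J.
have sub : [set f] :|: [set e] \subset L by rewrite subUset !sub1set fL.
have rfe : rk M ([set f] :|: [set e]) = 2 by rewrite pL // eq_sym.
have := rk_mono M (setUS J sub); rewrite rJ rfe rL (setUC J L).
by have := rkU_le M L J; have := rk_card M J; rewrite rL; lia.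
Qed.

(* q is represented as #|F| for a finite field F = GF(q). *)
Theorem theorem1p4 :
  forall F : finFieldType, exists n : nat,
    forall (T : finType) (M : matroid T),
      round M ->
      has_restriction M (U2_ground (#|F| + 2)) (@U2_rk (#|F| + 2)) ->
      has_minor M (PG_ground F n) (@PG_rk F n) ->
      has_minor M (U2_ground (#|F| ^ 2 + 1)) (@U2_rk (#|F| ^ 2 + 1)).
Proof.
move=> F; have [n1 n1P] := line_minor_or_skew 'rV[F]_3.
have [n2 n2P] := line_minor_or_skew 'rV[F]_n1.
(* Two points of [L] will be contracted, each at the cost of one dimension; the 3 keeps the
   dimension large enough for [pg_rep_avoid] both times. *)
exists (n2 + 3).+2 => T M /round_cover_of_round rM hL hP.
have q0 : 0 < #|F| by apply/card_gt0P; exists 0%R.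
apply: minor_of_line; first by rewrite addn1 ltnS expn_gt0 q0.
have [|L lL] := line_of_restriction _ hL; first by lia.
have [C [A [phi rep]]] := pg_rep_of_minor hP.
have [cL rL pL] := lL.
(* [I] is a largest part of [C] that is independent over [L]; it can be contracted while keeping [L]
   a line. *)
have [I [_ sIC rI rIC]] :=
  @extend_indep _ (contract M L) set0 C (sub0set _) (etrans (rk0 _) (esym (cards0 _))).
have rLI : rk M (L :|: I) = rk M L + #|I|.
  by rewrite setUC -rk_contract rI addnC.
have rMI : rk M I = #|I| by have := rk_skew_sub rLI (sub0set L); rewrite set0U rk0.
apply: (@line_minor_contract _ _ _ I); set N := contract M I.
have lN : line N (#|F| + 2) L by exact: line_contract.
have rN : round_cover N by exact: round_cover_contract.
(* What remains of [C] lies in the closure of [L]. *)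
have rCL : rk N (C :|: L) = 2.
  have := rk_contract M I (C :|: L); have := rk_contract M L C.
  rewrite setUAC (setUidPl sIC) rMI rL -/N; lia.
have repN : pg_rep (contract N C) A phi.
  by apply: pg_rep_ext rep => X; rewrite rk_contract2 (setUidPr sIC).
have [_ rNL pNL] := lN.
have /card_gt1P[e [f [eL fL ef]]] : 1 < #|L| by lia.
have [||] := pg_rep_avoid e repN (dim_rV F _); first by lia.
  exact: line_minor_contract.
case=> A1 [phi1 rep1].
have [||] := pg_rep_avoid f rep1 (dim_rV F _); first by lia.
  by move=> h; apply: line_minor_contract (line_minor_contract h).
case=> A2 [phi2 /pg_rep_le[A3 [phi3 rep3]]].
have [ref rNe rNf] : [/\ rk N [set e; f] = 2, rk N [set e] = 1 & rk N [set f] = 1].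
  have := pNL _ _ eL fL ef; have := rkU_le N [set e] [set f].
  by have := rk1_le N e; have := rk1_le N f; split; lia.
have {}rep3 : pg_rep (contract (contract N [set f]) [set e]) A3 phi3.
  apply: pg_rep_ext rep3 => X; rewrite (rk_contract2 (contract N C)) !(rk_contract2 N).
  (* [C] lies in the closure of [e] and [f], so once these are contracted, contracting [C] as well
     changes no rank. *)
  have cl : rk N ([set e; f] :|: C) = rk N [set e; f].
    apply/eqP; rewrite eqn_leq [X in _ && X]rk_mono ?subsetUl // andbT ref -rCL setUC.
    by rewrite rk_mono // setUS // subUset !sub1set eL.
  have := rkU_id (subsetUr X [set e; f]) cl.
  have := rk_contract N (C :|: ([set e] :|: [set f])) X.
  have := rk_contract N ([set f] :|: [set e]) X.
  rewrite (setUC [set f]) (setUC C) (setUA X [set e; f] C) cl; lia.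
have re_f : rk (contract N [set f]) [set e] = 1.
  by have := rk_contract N [set f] [set e]; rewrite ref rNf; lia.
(* First undo the contraction of [e], working in [N / f]; a geometry of dimension [n1] remains. *)
have [h|[I1 [A4 [phi4 [sI1 rI1 rep4 rep4e]]]]] := n2P _ _ _ _ _ re_f rep3.
  exact: line_minor_contract h.
have lN1 := line_contract_pair lN eL fL ef rI1.
have [_ rN1 pN1] := lN1.
have rf1 : rk (contract N I1) [set f] = 1.
  have := pN1 _ _ eL fL ef; have := rkU_le (contract N I1) [set e] [set f].
  by have := rk1_le (contract N I1) e; have := rk1_le (contract N I1) f; lia.
have rep5 : pg_rep (contract (contract N I1) [set f]) A4 phi4.
  by apply: pg_rep_ext rep4 => X; rewrite rk_contractC.
apply: (@line_minor_contract _ _ _ I1).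
(* Then undo the contraction of [f]; dimension 3 remains, as [line_minor_round] requires. *)
have [//|[I2 [A6 [phi6 [sI2 rI2 rep6 _]]]]] := n1P _ _ _ _ _ rf1 rep5.
apply: (@line_minor_contract _ _ _ I2).
have lN2 : line (contract (contract N I1) I2) (#|F| + 2) L.
  apply: line_contract_pair lN1 eL fL ef _.
  (* [I2] is known to be independent over [f] only. It lies in [A4], where ranks are the same with
     and without contracting [e], so it is independent over [e] and [f] together. *)
  rewrite -rI2 rep5.1 // -rep4e.1 // !rk_contract2.
  by congr (rk (contract M _) _); seteq.
apply: line_minor_round rep6 _ lN2; last by rewrite dim_rV.
by do 2!apply: round_cover_contract.
Qed.
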